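(* Let $(\mathcal{X},d)$ be a finite metric space, and $c(x,y)=d(x,y)$. Then \[ r_{c}^{*}(\mathcal{P}(\mathcal{X}))<55.7\left(1+\log|\mathcal{X}|\right). \]
   Context: Logarithms are natural. Polish spaces carry their Borel $\sigma$-algebras. A symmetric cost function over a Polish space $\mathcal{X}$ is a function $c:\mathcal{X}^2\to[0,\infty)$ that is measurable with respect to the product $\sigma$-algebra, symmetric, not identically zero, and satisfies $c(x,x)=0$ for all $x$. $\mathcal{P}(\mathcal{X})$ is the set of all probability distributions over $\mathcal{X}$. A coupling of a collection $\{P_\alpha\}_{\alpha\in\mathcal{A}}$ of probability distributions over $\mathcal{X}$ ($\mathcal{A}$ an arbitrary index set) is a family of random variables $X_\alpha:[0,1]\to\mathcal{X}$, all defined on the standard probability space ($[0,1]$, Lebesgue measurable sets, Lebesgue measure), with $X_\alpha\sim P_\alpha$ for every $\alpha$. For $P,Q\in\mathcal{P}(\mathcal{X})$, $C_c^*(P,Q):=\inf\mathbf{E}[c(X,Y)]$ over couplings $(X,Y)$ of $(P,Q)$. The pairwise coupling ratio of a coupling is $r_c(\{X_\alpha\}_{\alpha}):=\inf\{r\ge1:\mathbf{E}[c(X_\alpha,X_\beta)]\le r\,C_c^*(P_\alpha,P_\beta)\ \forall\alpha,\beta\in\mathcal{A}\}$ ($\infty$ if no such $r$ exists), and $r_c^*(\{P_\alpha\}_{\alpha}):=\inf r_c(\{X_\alpha\}_\alpha)$ over all couplings of $\{P_\alpha\}_\alpha$. A set of probability distributions, such as $\mathcal{P}(\mathcal{X})$,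 is regarded as a collection indexed by itself. *)

(* Defs.v *)
From HB Require Import structures.
From mathcomp Require Import all_boot all_order all_algebra.
From mathcomp Require Import all_classical all_reals all_analysis.

Set Implicit Arguments.
Unset Strict Implicit.
Unset Printing Implicit Defensive.

Import Order.TTheory GRing.Theory Num.Theory.
Import numFieldNormedType.Exports.

Local Open Scope classical_set_scope.
Local Open Scope ring_scope.

(* Measurable types are pointed, hence the Pointed structure: metric spaces
   are taken to be nonempty. *)
#[short(type="finMetricType")]
HB.structure Definition FinMetric (R : numDomainType) :=
  { X of Metric R X & Pointed X & Finite X }.

Definition borel (R : realType) (X : finMetricType R) :=
  g_sigma_algebraType (@open X).

(* The reals with the Lebesgue measurable sets, on which
   completed_lebesgue_measure is defined. *)
Definition lebesgueType (R : realType) :=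
  caratheodory_type ((wlength (@idfun R))^*)%mu.

(* The sample space [0, 1], as a subset of lebesgueType R: values of random
   variables outside of it are irrelevant. *)
Definition Omega (R : realType) : set (lebesgueType R) :=
  [set` `[0, 1]%R : interval R].
Arguments Omega : clear implicits.

Section coupling.
Context (R : realType) (d : measure_display) (T : measurableType d).
Implicit Types (P Q : probability T R) (c : T -> T -> R)
  (X Y : lebesgueType R -> T).
Local Open Scope ereal_scope.

Definition has_law X P :=
  measurable_fun (Omega R) X /\
  forall B, measurable B ->
    completed_lebesgue_measure (Omega R `&` X @^-1` B) = P B.

Definition expected_cost c X Y : \bar R :=
  \int[completed_lebesgue_measure]_(w in Omega R) (c (X w) (Y w))%:E.

Definition optimal_cost c P Q : \bar R :=
  ereal_inf [set e | exists X Y,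
    [/\ has_law X P, has_law Y Q & e = expected_cost c X Y]].

Definition coupling (A : Type) (P : A -> probability T R)
    (X : A -> lebesgueType R -> T) :=
  forall a, has_law (X a) (P a).

(* The infimum of the empty set is +oo. *)
Definition coupling_ratio c (A : Type) (P : A -> probability T R)
    (X : A -> lebesgueType R -> T) : \bar R :=
  ereal_inf [set r%:E | r in [set r : R | (1 <= r)%R /\
    forall a b, expected_cost c (X a) (X b)
                <= r%:E * optimal_cost c (P a) (P b)]].

Definition optimal_coupling_ratio c (A : Type) (P : A -> probability T R) :
    \bar R :=
  ereal_inf [set coupling_ratio c P X | X in coupling P].

End coupling.

(* Main.v *)
Require Import Defs.
From HB Require Import structures.
From mathcomp Require Import all_boot all_order all_algebra.
From mathcomp Require Import fingroup perm.
From mathcomp Require Import all_classical all_reals all_analysis.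
From mathcomp Require Import measurable_realfun ring lra.

Set Implicit Arguments.
Unset Strict Implicit.
Unset Printing Implicit Defensive.

Import Order.TTheory GRing.Theory Num.Theory.
Import numFieldNormedType.Exports.

Local Open Scope classical_set_scope.
Local Open Scope ring_scope.

(** A coupling of all distributions on [X] at once is a rule that turns one
    sample point [w] into a point of [X] for every distribution [p].  The rule
    is to draw a random hierarchy of finer and finer partitions of [X], the same
    for all [p], and then to descend the hierarchy, drawing at each level a cell
    from [p] conditioned on the cells drawn before.  With [n = #|X|], it couples
    every pair at cost at most [54 * (1 + 1/2 + ... + 1/n)] times the optimal
    one, and the harmonic sum is at most [1 + ln n].

    One draw.  Rejection sampling with shared proposals (Kleinberg and Tardos)
    proposes in each round a uniform [i] and a uniform threshold [v], and [p]
    accepts [i] when [v < p i].  The first round in which [p] or [q] accepts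
    decides whether they agree, so two laws disagree with probability at most
    [\sum_i |p i - q i|] ([pr_sample_neq]).

    One hierarchy.  If a level splits sets of diameter at most [D], two descents
    that separate there end at distance at most [D].  Summing over the levels
    bounds the mean distance of the two points by a seminorm of [p - q], namely
    the total of [2 * D * |p(C) - q(C)|] over all cells [C] ([le_tree_norm]).
    As [p - q] is the average of [dirac x - dirac y] under any coupling of [p]
    and [q], convexity reduces the estimate to pairs of points: a level that
    separates [x] and [y] costs four times the diameters from there on
    ([mean_cost_coupling]).

    The random hierarchy.  At level [l] a point joins the point of highest
    priority within distance [r = 3^-l * top * (1 + 2 * u)], for one uniform [u]
    and one uniform order of priorities (Calinescu, Karloff and Rabani).  A point
    [v] separates [x] from [y] only if [r] lies between its distances to [x] and
    to [y], and if [v] comes before all points that are at least as close to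
    the pair as [v].  The second event has probability at most one over the rank of [v]
    in the order of closeness, which gives the harmonic sum; the first one,
    weighted by the scale, sums over the levels to at most [d x y / 2], because
    the ranges of [r] at different levels do not overlap.  The diameters decrease
    by factors of three and start at [18] scales, so that the weight of a level
    is at most [4 * 18 * 3/2 = 108] scales, whence [54] ([expected_cut_cost]).

    Randomness.  The even and the odd binary digits of a uniform number form two
    independent uniform numbers ([even_bits_indep]); iterating this split
    supplies all the draws from a single point of [[0, 1]]. *)

(** * Probabilities as real numbers *)

Section real_probability.
Context (R : realType) (d : measure_display) (T : measurableType d).
Variable P : probability T R.

Definition pr (A : set T) : R := fine (P A).

Lemma prE A : measurable A -> P A = (pr A)%:E.
Proof. by move=> mA; rewrite /pr fineK// fin_num_measure. Qed.

Lemma pr_ge0 A : 0 <= pr A.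
Proof. by rewrite fine_ge0. Qed.

Lemma pr_set0 : pr set0 = 0.
Proof. by rewrite /pr measure0. Qed.

Lemma pr_setT : pr setT = 1.
Proof. by rewrite /pr probability_setT. Qed.

Lemma le_pr A B : measurable A -> measurable B -> A `<=` B -> pr A <= pr B.
Proof. by move=> mA mB AB; rewrite -lee_fin -!prE// le_measure ?inE. Qed.

Lemma pr_le1 A : measurable A -> pr A <= 1.
Proof. by move=> mA; rewrite -pr_setT; apply: le_pr. Qed.

Lemma prU A B : measurable A -> measurable B -> A `&` B = set0 ->
  pr (A `|` B) = pr A + pr B.
Proof.
move=> mA mB AB0; apply: EFin_inj; rewrite EFinD -!prE//;
  last exact: measurableU.
by rewrite measureU.
Qed.

Lemma pr_subU A B C : measurable A -> measurable B -> measurable C ->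
  A `<=` B `|` C -> pr A <= pr B + pr C.
Proof.
move=> mA mB mC ABC; rewrite -lee_fin EFinD -!prE//.
apply: le_trans (measureU2 _ mB mC).
by rewrite le_measure ?inE//; exact: measurableU.
Qed.

Lemma pr_sub_sum (I : Type) (s : seq I) (Q : pred I) (A : set T)
    (B : I -> set T) :
  measurable A -> (forall i, measurable (B i)) ->
  A `<=` \big[setU/set0]_(i <- s | Q i) B i ->
  pr A <= \sum_(i <- s | Q i) pr (B i).
Proof.
move=> mA mB; elim: s A mA => [|i s IH] A mA.
  rewrite !big_nil subset0 => ->.
  by rewrite pr_set0.
rewrite !big_cons; case: ifP => _; last exact: IH.
move=> AB; have mU : measurable (\big[setU/set0]_(j <- s | Q j) B j).
  by apply: bigsetU_measurable.
apply: le_trans (pr_subU mA (mB i) mU AB) _.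
by rewrite lerD2l; apply: IH.
Qed.

Lemma pr_bigU (I : finType) (s : seq I) (B : I -> set T) : uniq s ->
  (forall i, measurable (B i)) ->
  (forall i j w, B i w -> B j w -> i = j) ->
  pr (\big[setU/set0]_(i <- s) B i) = \sum_(i <- s) pr (B i).
Proof.
move=> us mB tB; elim: s us => [|i s IH] us; first by rewrite !big_nil pr_set0.
move: us; rewrite cons_uniq => /andP[nis us].
rewrite !big_cons prU ?IH//; first exact: bigsetU_measurable.
rewrite -subset0 => w [Biw]; rewrite -bigcup_seq => -[j /= js Bjw].
by move: nis; rewrite (tB _ _ _ Biw Bjw) js.
Qed.

(** Random elements of a finite type are handled through their fibers, without
    putting a sigma-algebra on the type. *)
Definition rfin (I : Type) (Z : T -> I) :=
  forall i, measurable [set w | Z w = i].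

Lemma rfin_pred (I : finType) (Z : T -> I) (Q : set I) : rfin Z ->
  measurable [set w | Q (Z w)].
Proof.
move=> mZ; rewrite (_ : [set _ | _] =
   \big[setU/set0]_(i <- enum I | `[< Q i >]) [set w | Z w = i]).
  exact: bigsetU_measurable.
rewrite -bigcup_seq_cond; apply/seteqP; split => w /=.
  by move=> QZ; exists (Z w) => //=; rewrite mem_enum/=; apply/asboolP.
by move=> [i /= /andP[_ /asboolP Qi] ->].
Qed.

Lemma pr_total (I : finType) (Z : T -> I) (A : set T) : rfin Z ->
  measurable A -> pr A = \sum_i pr (A `&` [set w | Z w = i]).
Proof.
move=> mZ mA; rewrite -big_enum/= -pr_bigU ?enum_uniq//.
- congr pr; rewrite -bigcup_seq; apply/seteqP; split => w /=.
    by move=> Aw; exists (Z w) => //=; rewrite mem_enum.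
  by move=> [i _ []].
- by move=> i; apply: measurableI.
- by move=> i j w [_ /= <-] [].
Qed.

End real_probability.

Lemma eq_measure_rays (R : realType) (m1 m2 : {measure set R -> \bar R}) :
  (forall x, m1 `]-oo, x[ = m2 `]-oo, x[)%classic ->
  (m1 setT < +oo)%E -> forall A, measurable A -> m1 A = m2 A.
Proof.
move=> m12 m1oo; apply: (measure_unique (@RGenInftyO.G R)
    (fun n => `]-oo, (n%:R : R)[%classic)).
- exact: RGenInftyO.measurableE.
- move=> _ _ [x ->] [y ->]; exists (Num.min x y).
  by apply/seteqP; split => z /=; rewrite !in_itv/= lt_min => /andP.
- by move=> n; exists n%:R.
- apply/seteqP; split => // x _; exists (Num.bound `|x|) => //=.
  by rewrite in_itv/= (le_lt_trans (ler_norm x))// archi_boundP.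
- by move=> _ [x ->].
- by move=> n; apply: le_lt_trans m1oo; rewrite le_measure ?inE.
Qed.

(** A factorisation that holds for all rays in the values of [Z] holds for all
    Borel sets.  Used for one variable at a time, this proves independence from
    joint distribution functions. *)
Lemma eq_pr_rays (R : realType) (d : measure_display) (T : measurableType d)
    (P : probability T R) (Q : probability R R) (E : set T) (Z : T -> R)
    (c : R) :
  measurable E -> measurable_fun setT Z -> 0 <= c ->
  (forall x, pr P (E `&` [set w | Z w < x]) = c * pr Q `]-oo, x[%classic) ->
  forall A, measurable A -> pr P (E `&` Z @^-1` A) = c * pr Q A.
Proof.
move=> mE mZ c0 PQ A mA.
have mZA B : measurable B -> measurable (Z @^-1` B).
  by move=> mB; rewrite -[X in measurable X]setTI; exact: mZ.
(* The image of a measure is a measure only given the measurability of [Z],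
   which the structure has to receive explicitly. *)
have := @eq_measure_rays R
  (measure_function_pushforward__canonical__measure_function_Measure
     (mrestr P mE) mZ) (mscale (NngNum c0) Q).
rewrite /= /pushforward /mscale /mrestr/= => H.
apply: EFin_inj; rewrite EFinM -!prE//; last by apply: measurableI => //;
  exact: mZA.
rewrite setIC; apply: H => //.
- move=> x; rewrite setIC !prE//; last by apply: measurableI => //; exact: mZA.
  by rewrite -EFinM -PQ; congr ((pr _ (_ `&` _))%:E);
    apply/seteqP; split => w /=; rewrite in_itv.
- rewrite preimage_setT setTI (le_lt_trans (probability_le1 _ _))//.
  exact: ltry.
Qed.
Lemma measurable_preimage (d d' : measure_display) (T : measurableType d)
    (T' : measurableType d') (f : T -> T') (B : set T') :
  measurable_fun setT f -> measurable B -> measurable (f @^-1` B).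
Proof. by move=> mf mB; rewrite -[X in measurable X]setTI; exact: mf. Qed.

Lemma measurable_lt (R : realType) (d : measure_display) (T : measurableType d)
  (f : T -> R) x : measurable_fun setT f -> measurable [set w | f w < x].
Proof.
move=> mf; rewrite (_ : [set _ | _] = f @^-1` `]-oo, x[).
  exact: measurable_preimage.
by apply/seteqP; split=> w /=; rewrite in_itv.
Qed.

(** * Two independent uniform numbers from one *)

Section bit_splitting.
Context (R : realType).
Implicit Types x y u : R.

(** The uniform law, on [R] with its Borel sets, so that the sample space has
    measurable maps to itself. *)
Definition unif (A : set R) : \bar R := uniform_prob (@ltr01 R) A.

Let unif0 : unif set0 = 0%E. Proof. exact: measure0. Qed.
Let unif_ge0 A : (0 <= unif A)%E. Proof. exact: measure_ge0. Qed.
Let unif_sigma_additive : semi_sigma_additive unif.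
Proof. exact: (@measure_semi_sigma_additive _ _ _ (uniform_prob (@ltr01 R))). Qed.

HB.instance Definition _ := isMeasure.Build _ R R unif
  unif0 unif_ge0 unif_sigma_additive.

Let unif_setT : unif setT = 1%E.
Proof. exact: (@probability_setT _ _ _ (uniform_prob (@ltr01 R))). Qed.

HB.instance Definition _ := Measure_isProbability.Build _ R R unif unif_setT.

Definition clamp (a b x : R) : R := Num.min b (Num.max a x).

Lemma unifE (A : set R) : measurable A ->
  unif A = lebesgue_measure (A `&` `[0, 1]%classic).
Proof.
move=> mA; rewrite /unif/= /uniform_prob integral_uniform_pdf.
rewrite (eq_integral (cst 1%E)); last first.
  move=> x; rewrite inE/= => -[_]; rewrite in_itv/= => x01.
  by rewrite /uniform_pdf x01 subr0 invr1.
by rewrite integral_cst ?mul1e//; exact: measurableI.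
Qed.

Lemma unif_ray x : pr unif `]-oo, x[%classic = clamp 0 1 x.
Proof.
rewrite /pr/= unifE//.
have [x0|x0] := leP x 0.
  rewrite (_ : _ `&` _ = set0) ?measure0//=; last first.
    by apply/seteqP; split => z //=; rewrite !in_itv/=; lra.
  by rewrite /clamp (max_idPl x0) (min_idPr ler01).
have [x1|x1] := leP x 1.
  rewrite (_ : _ `&` _ = `[0, x[%classic); last first.
    by apply/seteqP; split => z /=; rewrite !in_itv/=; lra.
  rewrite lebesgue_measure_itv/= lte_fin x0 -EFinB subr0/=.
  by rewrite /clamp (max_idPr (ltW x0)) (min_idPr x1).
rewrite (_ : _ `&` _ = `[0, 1]%classic); last first.
  by apply/seteqP; split => z /=; rewrite !in_itv/=; lra.
rewrite lebesgue_measure_itv/= lte_fin ltr01 -EFinB subr0/=.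
by rewrite /clamp (max_idPr (ltW x0)) (min_idPl (ltW x1)).
Qed.

Lemma unif_itv x y : 0 <= x -> x <= y -> y <= 1 ->
  pr unif `[x, y[%classic = y - x.
Proof.
move=> x0 xy y1.
have : pr unif (`]-oo, x[ `|` `[x, y[)%classic =
    pr unif `]-oo, x[%classic + pr unif `[x, y[%classic.
  by apply: prU => //; apply/seteqP; split => z //=; rewrite !in_itv/=; lra.
rewrite (_ : _ `|` _ = `]-oo, y[%classic); last first.
  by apply/seteqP; split => z /=; rewrite !in_itv/=; lra.
rewrite !unif_ray /clamp (max_idPr x0) (min_idPr (le_trans xy y1)).
rewrite (max_idPr (le_trans x0 xy)) (min_idPr y1); lra.
Qed.

(** Sample points outside of [[0, 1[] are negligible. *)
Lemma unif_event a b (A : set R) : 0 <= a -> a <= b -> b <= 1 ->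
  measurable A -> (forall u, 0 <= u -> u < 1 -> (A u <-> a <= u < b)) ->
  pr unif A = b - a.
Proof.
move=> a0 ab b1 mA Aab; rewrite -unif_itv//; apply/le_anti/andP; split.
  have N0 : pr unif (~` `[0, 1[%classic) = 0.
    have mC : measurable (~` `[0, 1[%classic : set R) by exact: measurableC.
    have := @prU _ _ _ unif `[0, 1[%classic _ (measurable_itv _) mC (setICr _).
    by rewrite setUv pr_setT unif_itv//; lra.
  rewrite -[leRHS]addr0 -N0; apply: pr_subU => //.
    exact: measurableC.
  move=> u Au; have [u01|] := boolP (0 <= u < 1).
    by left; rewrite /= in_itv/=; apply/Aab => //; case/andP: u01.
  by move=> /negP u01; right; rewrite /= in_itv.
apply: le_pr => // u /=; rewrite in_itv/= => uab.
by apply/Aab => //; move: uab => /andP[]; lra.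
Qed.

(** The leading binary digit of [u], and the number formed by the others. *)
Definition bit u : bool := 2^-1 <= u.
Definition shift u : R := 2 * u - (bit u)%:R.

Lemma measurable_bit : measurable_fun setT bit.
Proof. exact: measurable_fun_ler. Qed.

Lemma measurable_bitr : measurable_fun setT (fun u => (bit u)%:R : R).
Proof.
rewrite (_ : (fun u => _) = (fun u => if bit u then 1 else 0)).
  by apply: measurable_fun_ifT => //; exact: measurable_bit.
by apply/funext => u; case: bit.
Qed.

Lemma measurable_shift : measurable_fun setT shift.
Proof.
apply: measurable_funB; first exact: measurable_funM.
exact: measurable_bitr.
Qed.

Lemma measurable_set_bit b : measurable [set u | bit u = b].
Proof.
rewrite (_ : [set _ | _] = setT `&` bit @^-1` [set b]) ?setTI//.
exact: (measurable_preimage measurable_bit).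
Qed.

(** The leading digit is a fair coin that is independent of the others. *)
Lemma pr_bit_shift b (A : set R) : measurable A ->
  pr unif ([set u | bit u = b] `&` shift @^-1` A) = 2^-1 * pr unif A.
Proof.
have mbs x c : measurable ([set u | bit u = c] `&` [set u | shift u < x]).
  apply: measurableI; first exact: measurable_set_bit.
  by apply: measurable_lt; exact: measurable_shift.
apply: eq_pr_rays; [exact: measurable_set_bit|exact: measurable_shift|lra|].
move=> x; rewrite unif_ray.
have [c0 c1] : 0 <= clamp 0 1 x /\ clamp 0 1 x <= 1.
  by split; rewrite /clamp ?ge_min ?le_min ?le_max ?lexx ?ler01.
have cx u : 0 <= u -> u < 1 -> (u < clamp 0 1 x) = (u < x).
  by move=> u0 u1; rewrite /clamp lt_min lt_max u1/= ltNge u0.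
case: b.
  rewrite (@unif_event 2^-1 (2^-1 + 2^-1 * clamp 0 1 x)) //; try lra.
  move=> u u0 u1 /=; rewrite /shift /bit.
  have [u2|u2] := lerP 2^-1 u; last by split=> [[]|] //; lra.
  rewrite [1%:R]/=.
  have : (2 * u - 1 < clamp 0 1 x) = (2 * u - 1 < x) by apply: cx; lra.
  move=> E; split=> [[_]|]; first by rewrite -E; lra.
  by move=> H; split => //; rewrite -E; lra.
rewrite (@unif_event 0 (2^-1 * clamp 0 1 x)) //; try lra.
move=> u u0 u1 /=; rewrite /shift /bit.
have [u2|u2] := lerP 2^-1 u; first by split=> [[]|] //; lra.
have : (2 * u < clamp 0 1 x) = (2 * u < x) by apply: cx; lra.
rewrite subr0 => E; split=> [[_]|]; first by rewrite -E; lra.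
by move=> H; split => //; rewrite -E; lra.
Qed.

Lemma pr_shift (A : set R) : measurable A ->
  pr unif (shift @^-1` A) = pr unif A.
Proof.
move=> mA; rewrite (@pr_total _ _ _ unif bool bit); last 2 first.
- exact: measurable_set_bit.
- exact: (measurable_preimage measurable_shift).
by rewrite big_bool/= !(setIC (shift @^-1` A)) !pr_bit_shift//; lra.
Qed.

(** The number whose digits are those of [u] at every other place, starting
    with the leading one, cut off after [n] digits. *)
Fixpoint even_bits_approx n u : R :=
  if n is n'.+1 then
    ((bit u)%:R + even_bits_approx n' (shift (shift u))) / 2
  else 0.

Lemma even_bits_approx_ge0 n u : 0 <= even_bits_approx n u.
Proof.
by elim: n u => //= n IH u; have := IH (shift (shift u)); case: bit => /=; lra.
Qed.

Lemma even_bits_approx_le1 n u : even_bits_approx n u <= 1.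
Proof.
by elim: n u => //= n IH u; have := IH (shift (shift u)); case: bit => /=; lra.
Qed.

Lemma even_bits_approx_nondecreasing u :
  nondecreasing_seq (even_bits_approx ^~ u).
Proof.
apply/nondecreasing_seqP => n; elim: n u => [|n IH] u.
  exact: even_bits_approx_ge0 1%N u.
by have := IH (shift (shift u)); move=> /=; lra.
Qed.

Definition even_bits u : R := limn (even_bits_approx ^~ u).

Lemma even_bits_approx_cvg u : even_bits_approx ^~ u @ \oo --> even_bits u.
Proof.
apply: nondecreasing_is_cvgn; first exact: even_bits_approx_nondecreasing.
by exists 1 => _ [n _ <-]; exact: even_bits_approx_le1.
Qed.

Lemma even_bits_ge0 u : 0 <= even_bits u.
Proof.
apply: limr_ge; first exact: even_bits_approx_cvg.
by apply: nearW => n; exact: even_bits_approx_ge0.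
Qed.

Lemma even_bits_le1 u : even_bits u <= 1.
Proof.
apply: limr_le; first exact: even_bits_approx_cvg.
by apply: nearW => n; exact: even_bits_approx_le1.
Qed.

Lemma even_bitsE u :
  even_bits u = ((bit u)%:R + even_bits (shift (shift u))) / 2.
Proof.
apply: cvg_lim => //; rewrite -(cvg_shiftS (even_bits_approx ^~ u)) /=.
apply: cvgMl; apply: cvgD; first exact: cvg_cst.
exact: even_bits_approx_cvg.
Qed.

Lemma measurable_even_bits_approx n : measurable_fun setT (even_bits_approx n).
Proof.
elim: n => [|n IH] /=; first exact: measurable_cst.
apply: measurable_funM => //; apply: measurable_funD;
  first exact: measurable_bitr.
apply: (measurableT_comp IH); apply: (measurableT_comp measurable_shift).
exact: measurable_shift.
Qed.

Lemma measurable_even_bits : measurable_fun setT even_bits.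
Proof.
apply: (measurable_fun_cvg measurable_even_bits_approx) => u _.
exact: even_bits_approx_cvg.
Qed.

(** The even places of the shifted number are the odd places of [u]. *)
Definition odd_bits u := even_bits (shift u).

Lemma measurable_odd_bits : measurable_fun setT odd_bits.
Proof. exact: (measurableT_comp measurable_even_bits measurable_shift). Qed.

(* The joint distribution function of the two numbers, to be compared with the
   product of uniform distribution functions. *)
Let F x y := pr unif ([set u | even_bits u < x] `&` [set u | odd_bits u < y]).
Let C x := clamp 0 1 x.

(* Removing the leading digit of [u] removes the leading digit of the first
   number and exchanges the roles of the two. *)
Let FE x y : F x y = 2^-1 * (F y (2 * x) + F y (2 * x - 1)).
Proof.
have mF : measurable ([set u | even_bits u < x] `&` [set u | odd_bits u < y]).
  apply: measurableI; apply: measurable_lt;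
    [exact: measurable_even_bits|exact: measurable_odd_bits].
have mF' z : measurable ([set u | even_bits u < y] `&`
  [set u | odd_bits u < z]).
  apply: measurableI; apply: measurable_lt;
    [exact: measurable_even_bits|exact: measurable_odd_bits].
rewrite /F (@pr_total _ _ _ unif bool bit)//; last exact: measurable_set_bit.
rewrite big_bool/= mulrDr addrC -(pr_bit_shift false (mF' (2 * x))).
rewrite -(pr_bit_shift true (mF' (2 * x - 1))).
congr (_ + _); congr pr; apply/seteqP; split=> u /=;
  rewrite (even_bitsE u) /odd_bits.
- move=> [[h1 h2] h3]; move: h1; rewrite h3/= => h1; do 2 split => //; lra.
- move=> [h3 [h1 h2]]; rewrite h3/=; do 2 split => //; lra.
- move=> [[h1 h2] h3]; move: h1; rewrite h3/= => h1; do 2 split => //; lra.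
- move=> [h3 [h1 h2]]; rewrite h3/=; do 2 split => //; lra.
Qed.

Let F_le0 x y : x <= 0 -> F x y = 0.
Proof.
move=> x0; rewrite /F (_ : _ `&` _ = set0) ?pr_set0//.
by apply/seteqP; split=> u //= []; have := even_bits_ge0 u; lra.
Qed.

Let F_le0r x y : y <= 0 -> F x y = 0.
Proof.
move=> y0; rewrite /F (_ : _ `&` _ = set0) ?pr_set0//.
by apply/seteqP; split=> u //= []; have := even_bits_ge0 (shift u);
  rewrite /odd_bits; lra.
Qed.

(* Both numbers have the same law, as [shift] preserves the measure. *)
Let F_sym1 x y : 1 < x -> F x y = F y x.
Proof.
move=> x1; rewrite /F (_ : _ `&` _ = shift @^-1` [set u | even_bits u < y]).
  rewrite pr_shift; last exact: measurable_lt measurable_even_bits.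
  congr pr; apply/seteqP; split=> u /=; last by case.
  by split => //; have := even_bits_le1 (shift u); rewrite /odd_bits; lra.
apply/seteqP; split=> u /=; first by case.
by split => //; have := even_bits_le1 u; lra.
Qed.

Let C_le0 x : x <= 0 -> C x = 0.
Proof. by move=> x0; rewrite /C /clamp (max_idPl x0) (min_idPr ler01). Qed.

Let C_ge1 x : 1 <= x -> C x = 1.
Proof.
by move=> x1; rewrite /C /clamp (max_idPr (le_trans ler01 x1)) (min_idPl x1).
Qed.

Let C_id x : 0 <= x -> x <= 1 -> C x = x.
Proof. by move=> x0 x1; rewrite /C /clamp (max_idPr x0) (min_idPr x1). Qed.

Let F_01 x y : 0 <= F x y <= 1.
Proof.
rewrite pr_ge0 pr_le1//; apply: measurableI; apply: measurable_lt;
  [exact: measurable_even_bits|exact: measurable_odd_bits].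
Qed.

Let C_01 x : 0 <= C x <= 1.
Proof. by rewrite /C /clamp ge_min !le_min le_max !lexx ler01. Qed.

Let F_gt1 x y : 1 < x -> 1 < y -> F x y = 1.
Proof.
move=> x1 y1; rewrite /F (_ : _ `&` _ = setT) ?pr_setT//.
apply/seteqP; split=> u //= _.
by have := even_bits_le1 u; have := even_bits_le1 (shift u); rewrite /odd_bits;
  lra.
Qed.

(* In the recursion [FE], one of the two arguments [2 * x] and [2 * x - 1] lies
   outside of [[0, 1]], where the distribution function is known.  The other
   term carries the factor [1/2], so each step halves the error. *)
Let F_marginal n x : `|F x 2 - C x| <= 2^-1 ^+ n.
Proof.
elim: n x => [|n IH] x.
  by rewrite expr0 ler_norml; have := F_01 x 2; have := C_01 x; lra.
have e0 : 0 <= (2^-1 : R) ^+ n.+1 by rewrite exprn_ge0.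
have [x0|x0] := leP x 0; first by rewrite F_le0// C_le0// subrr normr0.
have [x1|x1] := leP x 1; last by rewrite F_gt1 ?C_ge1 ?subrr ?normr0; lra.
rewrite FE ![F 2 _]F_sym1; [|lra..].
have [x2|x2] := leP (2 * x) 1.
  rewrite [F (2 * x - 1) _]F_le0; last lra.
  have := IH (2 * x); rewrite exprS !ler_norml (C_id (x := x)) ?(C_id (x :=
    2 * x)); lra.
rewrite [F (2 * x) _]F_gt1; [|lra..].
have := IH (2 * x - 1).
by rewrite exprS !ler_norml (C_id (x := x)) ?(C_id (x := 2 * x - 1)); lra.
Qed.

Lemma expr_half_le0 (a : R) : (forall n, a <= 2^-1 ^+ n) -> a <= 0.
Proof.
move=> H; have c : (fun n => (2^-1 : R) ^+ n) @ \oo --> (0 : R).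
  by apply: cvg_expr; rewrite ger0_norm; lra.
rewrite -(cvg_lim _ c)//; apply: limr_ge; first by apply/cvg_ex; exists 0.
by apply: nearW.
Qed.

Let F_2 x : F x 2 = C x.
Proof.
apply/eqP; rewrite -subr_eq0 -normr_le0; apply: expr_half_le0 => n.
exact: F_marginal.
Qed.

Let F_gt1l x y : 1 < x -> F x y = C y.
Proof.
move=> x1; rewrite F_sym1// -F_2; congr pr; apply/seteqP; split=> u /= -[h1 h2];
  by split => //; have := even_bits_le1 (shift u); rewrite -/(odd_bits u); lra.
Qed.

(* The same contraction, now that the marginal law settles the case where one
   argument lies outside of [[0, 1]]. *)
Let F_diff n x y : `|F x y - C x * C y| <= 2^-1 ^+ n.
Proof.
elim: n x y => [|n IH] x y.
  rewrite expr0 ler_norml; have := F_01 x y.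
  have /andP[a0 a1] := C_01 x; have /andP[b0 b1] := C_01 y.
  have : 0 <= C x * C y by rewrite mulr_ge0.
  have : C x * C y <= 1 by rewrite mulr_ile1.
  lra.
have e0 : 0 <= (2^-1 : R) ^+ n.+1 by rewrite exprn_ge0.
have [x0|x0] := leP x 0; first by rewrite F_le0// C_le0// mul0r subrr normr0.
have [x1|x1] := leP x 1; last
  by rewrite F_gt1l// (C_ge1 (ltW x1)) mul1r subrr normr0.
rewrite FE (C_id (x := x)); [|lra..].
have [x2|x2] := leP (2 * x) 1.
  rewrite [F y (2 * x - 1)]F_le0r; last lra.
  have := IH y (2 * x); rewrite exprS !ler_norml (C_id (x := 2 * x)); lra.
have -> : F y (2 * x) = C y by rewrite -F_sym1// F_gt1l.
have := IH y (2 * x - 1).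
rewrite exprS !ler_norml (C_id (x := 2 * x - 1)); lra.
Qed.

Let FC x y : F x y = C x * C y.
Proof.
apply/eqP; rewrite -subr_eq0 -normr_le0; apply: expr_half_le0 => n.
exact: F_diff.
Qed.

Lemma even_bits_indep (A B : set R) : measurable A -> measurable B ->
  pr unif (even_bits @^-1` A `&` odd_bits @^-1` B) = pr unif A * pr unif B.
Proof.
move=> mA mB; apply: eq_pr_rays => //.
- exact: (measurable_preimage measurable_even_bits).
- exact: measurable_odd_bits.
- exact: pr_ge0.
move=> y; rewrite setIC mulrC; move: A mA; apply: eq_pr_rays.
- exact: measurable_lt measurable_odd_bits.
- exact: measurable_even_bits.
- exact: pr_ge0.
by move=> x; rewrite setIC -/(F x y) FC !unif_ray mulrC.
Qed.

End bit_splitting.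

(** * Rejection sampling *)

Section rfin_theory.
Context (R : realType) (d : measure_display) (T : measurableType d).

Lemma rfin_comp (I : finType) (J : Type) (Z : T -> I) (h : I -> J) :
  rfin Z -> rfin (h \o Z).
Proof. by move=> mZ j; exact: (rfin_pred (fun i => h i = j) mZ). Qed.

Lemma rfin_precomp (I : Type) (Z : T -> I) (f : T -> T) :
  rfin Z -> measurable_fun setT f -> rfin (Z \o f).
Proof. by move=> mZ mf i; exact: (measurable_preimage mf (mZ i)). Qed.

Lemma rfin_ffun (I J : finType) (Z : I -> T -> J) :
  (forall i, rfin (Z i)) -> rfin (fun w => [ffun i => Z i w]).
Proof.
move=> mZ h; rewrite (_ : [set _ | _] =
  \bigcap_(i in [set: I]) [set w | Z i w = h i]).
  by apply: fin_bigcap_measurable => // i _; exact: mZ.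
apply/seteqP; split=> w /=.
  by move=> <- i _ /=; rewrite ffunE.
by move=> H; apply/ffunP => i; rewrite ffunE; exact: H.
Qed.

Lemma rfin_pair (I J : finType) (Z : T -> I) (Y : T -> J) :
  rfin Z -> rfin Y -> rfin (fun w => (Z w, Y w)).
Proof.
move=> mZ mY [i j]; rewrite (_ : [set _ | _] = [set w | Z w = i] `&`
  [set w | Y w = j]).
  exact: measurableI.
by apply/seteqP; split=> w /= [-> ->].
Qed.

Lemma rfin_cst (I : Type) (i : I) : rfin (fun _ : T => i).
Proof.
move=> j; have [->|ij] := pselect (i = j).
  by rewrite (_ : [set _ | _] = setT)//; apply/seteqP; split.
by rewrite (_ : [set _ | _] = set0)//; apply/seteqP; split.
Qed.

Lemma rfin_bool (B : set T) (b : T -> bool) :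
  (forall w, b w <-> B w) -> measurable B -> rfin b.
Proof.
move=> bB mB [].
  by rewrite (_ : [set _ | _] = B)//; apply/seteqP; split=> w /bB.
rewrite (_ : [set _ | _] = ~` B); first exact: measurableC.
apply/seteqP; split=> w /=; first by move=> + /bB => ->.
by move=> nB; apply/negP => /bB.
Qed.

End rfin_theory.

(** A source of randomness that never runs dry: [f w] and [g w] are independent
    and distributed like [w] itself, hence can be split again, while [U] reads
    a uniform number off a sample point. *)
Record splits (R : realType) (d : measure_display) (T : measurableType d)
    (P : probability T R) (f g : T -> T) (U : T -> R) : Prop := {
  measurable_split1 : measurable_fun setT f ;
  measurable_split2 : measurable_fun setT g ;
  measurable_uniform : measurable_fun setT U ;
  unit_range : forall w, 0 <= U w < 1 ;
  split_indep : forall A B, measurable A -> measurable B ->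
    pr P (f @^-1` A `&` g @^-1` B) = pr P A * pr P B ;
  uniform_pr : forall a b : R, 0 <= a -> a <= b -> b <= 1 ->
    pr P [set w | a <= U w < b] = b - a }.

Section rejection_sampling.
Context (R : realType) (d : measure_display) (T : measurableType d).
Variables (P : probability T R) (f g : T -> T) (U : T -> R).
Hypothesis src : splits P f g U.

Let mf := measurable_split1 src.
Let mg := measurable_split2 src.
Let mU := measurable_uniform src.
Let indep := split_indep src.
Let uniform := uniform_pr src.

Lemma pr_fst A : measurable A -> pr P (f @^-1` A) = pr P A.
Proof.
by move=> mA; have := indep mA measurableT;
  rewrite preimage_setT setIT pr_setT mulr1.
Qed.

Lemma measurable_range a b : measurable [set w | a <= U w < b].
Proof.
rewrite (_ : [set _ | _] = U @^-1` `[a, b[);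
  first exact: (measurable_preimage mU).
by apply/seteqP; split=> w /=; rewrite in_itv.
Qed.

Section one_law.
Context (I : finType).
Implicit Types p q : I -> R.

Let N : R := #|I|%:R.

(** One uniform number [v] encodes a proposal and a threshold: the unit interval
    is cut into [N] parts of equal length, one for each [i], and [v] leads to
    acceptance of [i] when it falls into the initial fraction [p i] of that part. *)
Definition slot p i (v : R) : bool :=
  (enum_rank i)%:R / N <= v < ((enum_rank i)%:R + p i) / N.

Definition accept p (w : T) : option I := [pick i | slot p i (U w)].

Lemma measurable_slot p i : measurable [set w | slot p i (U w)].
Proof. exact: measurable_range. Qed.

Lemma rfin_accept p : rfin (accept p).
Proof.
have -> : accept p = (fun h : {ffun I -> bool} => [pick i | h i]) \o
                    (fun w => [ffun i => slot p i (U w)]).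
  by apply/funext => w /=; rewrite /accept; apply: eq_pick => i; rewrite ffunE.
apply: rfin_comp; apply: rfin_ffun => i.
by apply: rfin_bool (measurable_slot p i) => w.
Qed.

Definition dist p := (forall i, 0 <= p i) /\ \sum_i p i = 1.

Lemma dist_le1 p i : dist p -> p i <= 1.
Proof.
by move=> [p0 <-]; rewrite (bigD1 i)//= lerDl sumr_ge0.
Qed.

Lemma dist_N_gt0 p : dist p -> 0 < N.
Proof.
move=> [_ p1]; rewrite ltr0n; apply/card_gt0P.
have [i _|I0] := pickP I; first by exists i.
by move: p1; rewrite big_pred0// => /eqP; rewrite eq_sym oner_eq0.
Qed.

Lemma slot_inj p i j v : dist p -> slot p i v -> slot p j v -> i = j.
Proof.
move=> dp; have N0 := dist_N_gt0 dp.
rewrite /slot !ler_pdivrMr// !ltr_pdivlMr// => /andP[i1 i2] /andP[j1 j2].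
have := dist_le1 i dp; have := dist_le1 j dp => pj pi.
apply/enum_rank_inj/val_inj => /=.
by have [ij|ij|//] := ssrnat.ltngtP (enum_rank i) (enum_rank j);
  exfalso; move: ij; rewrite -(ler_nat R) -natr1; lra.
Qed.

Lemma acceptP p i w : dist p -> (accept p w = Some i) <-> slot p i (U w).
Proof.
move=> dp; rewrite /accept; case: pickP => [j sj|s0]; split => //.
- by move=> [<-].
- by move=> si; rewrite (slot_inj dp sj si).
- by rewrite s0.
Qed.

Lemma pr_slot_diff p q i : dist p -> dist q ->
  pr P [set w | slot p i (U w) != slot q i (U w)] = `|p i - q i| / N.
Proof.
wlog pq : p q / p i <= q i.
  move=> H dp dq; have [pq|/ltW pq] := leP (p i) (q i); first exact: H.
  by rewrite distrC -H//; congr pr; apply/seteqP; split => w /=; rewrite eq_sym.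
move=> dp dq; have N0 := dist_N_gt0 dp; have p0 := dp.1 i.
have r1 : (enum_rank i)%:R + 1 <= N by rewrite natr1 ler_nat.
have r0 : 0 <= (enum_rank i)%:R :> R by [].
have q1 := dist_le1 i dq.
rewrite ler0_norm ?subr_le0// opprB.
transitivity (((enum_rank i)%:R + q i) / N - ((enum_rank i)%:R + p i) / N);
  last first.
  by field; rewrite gt_eqF.
rewrite -uniform.
- congr pr; apply/seteqP; split => w /=;
    rewrite /slot !ler_pdivrMr// !ltr_pdivlMr//.
    have [h1|h1] := ltP (U w * N) ((enum_rank i)%:R + p i).
      by rewrite (_ : U w * N < _ + q i) ?eqxx//; lra.
    by rewrite andbF (le_trans _ h1)/= ?lerDl//; case: ltP.
  by move=> /andP[h1 h2]; rewrite h2 (le_trans _ h1)/= ?lerDl// ltNge h1.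
- by rewrite divr_ge0//; lra.
- by rewrite ler_pM2r ?invr_gt0//; lra.
- by rewrite ler_pdivrMr//; lra.
Qed.

Lemma pr_accept p i : dist p -> pr P [set w | accept p w = Some i] = p i / N.
Proof.
move=> dp; have N0 := dist_N_gt0 dp; have p0 := dp.1 i.
have r1 : (enum_rank i)%:R + 1 <= N by rewrite natr1 ler_nat.
have r0 : 0 <= (enum_rank i)%:R :> R by [].
have p1 := dist_le1 i dp.
transitivity (((enum_rank i)%:R + p i) / N - (enum_rank i)%:R / N); last first.
  by field; rewrite gt_eqF.
rewrite -uniform.
- by congr pr; apply/seteqP; split => w /(acceptP _ _ dp).
- by rewrite divr_ge0//; lra.
- by rewrite ler_pM2r ?invr_gt0//; lra.
- by rewrite ler_pdivrMr//; lra.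
Qed.

Lemma pr_reject p : dist p -> pr P [set w | accept p w = None] = 1 - N^-1.
Proof.
move=> dp; have mA := rfin_accept p.
pose B := \big[setU/set0]_(i <- enum I) [set w | accept p w = Some i].
have mB : measurable B by apply: bigsetU_measurable.
have -> : [set w | accept p w = None] = ~` B.
  rewrite /B -bigcup_seq; apply/seteqP; split => w /=.
    by move=> aN [i _ /=]; rewrite aN.
  case E : (accept p w) => [i|//] H; exfalso; apply: H; exists i => //=.
  by rewrite mem_enum.
have := prU P mB (measurableC mB) (setICr B).
rewrite setUv pr_setT /B pr_bigU ?enum_uniq//; last first.
  by move=> i k w /= -> [].
rewrite big_enum/=; under eq_bigr do rewrite pr_accept//.
by rewrite -mulr_suml dp.2; lra.
Qed.

(* Rounds are truncated first, which makes the measurability of the outcome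
   immediate.  The value [i0] stands for no acceptance at all. *)
Variable i0 : I.

Fixpoint sample_upto p n w : I :=
  if n is n'.+1 then
    if accept p (f w) is Some i then i else sample_upto p n' (g w)
  else i0.

Definition sample p w : I :=
  xget i0 [set i | exists n0, forall n, (n0 <= n)%N -> sample_upto p n w = i].

Lemma sample_upto_stable p w :
  exists n0, forall n, (n0 <= n)%N -> sample_upto p n w = sample p w.
Proof.
suff [i Hi] : exists i n0, forall n, (n0 <= n)%N -> sample_upto p n w = i.
  exact: (xgetPex i0 (ex_intro (fun i => exists n0, forall n, (n0 <= n)%N ->
    sample_upto p n w = i) i Hi)).
have [[n]|none] := pselect (exists n, accept p (f (iter n g w)) != None).
  elim: n w => [|n IH] w /=.
    by case E : (accept p (f w)) => [i|//] _; exists i, 1%N; case=> //= n _;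
      rewrite E.
  rewrite -iterS iterSr => /IH[i [n0 Hi]].
  case E : (accept p (f w)) => [j|]; first by exists j, 1%N; case=> //= m _;
    rewrite E.
  by exists i, n0.+1; case=> //= m mn; rewrite E; exact: Hi.
exists i0, 0%N => n _; elim: n w none => //= n IH w none.
case E : (accept p (f w)) => [j|]; first by case: none; exists 0%N;
  rewrite /= E.
by apply: IH => -[m Hm]; apply: none; exists m.+1; rewrite iterSr.
Qed.

Lemma sample_eq p w i :
  (exists n0, forall n, (n0 <= n)%N -> sample_upto p n w = i) -> sample p w = i.
Proof.
move=> [n0 H]; have [n1 H1] := sample_upto_stable p w.
by rewrite -(H1 (maxn n0 n1)) ?leq_maxr// H// leq_maxl.
Qed.

(** The outcome of the sampling after one rejection is a fresh copy of the
    sampling.  Both the law and the probability of disagreement follow from this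
    equation, without summing over the rounds. *)
Lemma sampleE p w :
  sample p w = if accept p (f w) is Some i then i else sample p (g w).
Proof.
case E : (accept p (f w)) => [i|]; apply: sample_eq.
  by exists 1%N; case=> //= n _; rewrite E.
have [n0 H] := sample_upto_stable p (g w).
by exists n0.+1; case=> //= n n0n; rewrite E; exact: H.
Qed.

Lemma rfin_sample_upto p n : rfin (sample_upto p n).
Proof.
elim: n => [|n IH] /=; first exact: rfin_cst.
have := rfin_pair (rfin_precomp (rfin_accept p) mf) (rfin_precomp IH mg).
exact: (rfin_comp (fun oi : option I * I =>
  if oi.1 is Some i then i else oi.2)).
Qed.

Lemma rfin_sample p : rfin (sample p).
Proof.
move=> i; rewrite (_ : [set _ | _] =
  \bigcup_n \bigcap_(m in [set m | (n <= m)%N]) [set w | sample_upto p m w =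
    i]).
  apply: bigcupT_measurable => n; apply: bigcap_measurable;
    first by exists n => /=.
  by move=> m _; exact: rfin_sample_upto.
apply/seteqP; split => w /=.
  by move=> <-; have [n0 H] := sample_upto_stable p w; exists n0.
by move=> [n0 _ H]; apply: sample_eq; exists n0.
Qed.

(** One round yields [pr (sample = i) = p i / N + (1 - 1/N) * pr (sample = i)]. *)
Lemma pr_sample p i : dist p -> pr P [set w | sample p w = i] = p i.
Proof.
move=> dp; have N0 := dist_N_gt0 dp.
have mS := rfin_sample p i.
have mA o := rfin_accept p o.
have E : [set w | sample p w = i] = f @^-1` [set w | accept p w = Some i] `|`
   (f @^-1` [set w | accept p w = None] `&` g @^-1` [set w | sample p w = i]).
  apply/seteqP; split => w /=; rewrite (sampleE p w).
    by case: (accept p (f w)) => [j ->|]; [left|right].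
  by move=> [->|[->]].
have : pr P [set w | sample p w = i] = p i / N + (1 - N^-1) *
  pr P [set w | sample p w = i].
  rewrite {1}E prU.
  - by rewrite pr_fst// pr_accept// indep// pr_reject.
  - exact: (measurable_preimage mf).
  - by apply: measurableI; [exact: (measurable_preimage mf)|exact: (measurable_preimage mg)].
  - by apply/seteqP; split => w //= -[h1 [h2 _]]; move: h1; rewrite /= h2.
move=> H; have {}H : pr P [set w | sample p w = i] * N^-1 = p i / N by lra.
by apply: (mulIf (x := N^-1)) H; rewrite invr_eq0 gt_eqF.
Qed.

(** Two laws disagree either in the first round, with probability at most
    [\sum_i |p i - q i| / N], or in a later one, for which the first round must
    have rejected. *)
Lemma pr_sample_neq p q : dist p -> dist q ->
  pr P [set w | sample p w != sample q w] <= \sum_i `|p i - q i|.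
Proof.
move=> dp dq; have N0 := dist_N_gt0 dp.
have mS : measurable [set w | sample p w != sample q w].
  exact: (rfin_pred (fun ij : I * I => ij.1 != ij.2)
    (rfin_pair (rfin_sample p) (rfin_sample q))).
have mA : measurable [set w | accept p w <> accept q w].
  exact: (rfin_pred (fun ij : option I * option I => ij.1 <> ij.2)
    (rfin_pair (rfin_accept p) (rfin_accept q))).
have mN := rfin_accept p None.
have mD i : measurable [set w | slot p i (U w) != slot q i (U w)].
  have mb s : rfin (fun w => slot s i (U w))
    by apply: rfin_bool (measurable_slot s i) => w.
  exact: (rfin_pred (fun ij : bool * bool => ij.1 !=
    ij.2) (rfin_pair (mb p) (mb q))).
have H1 : pr P [set w | accept p w <> accept q w] <= (\sum_i `|p i - q i|) / N.
  rewrite mulr_suml; under eq_bigr do rewrite -pr_slot_diff//.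
  apply: pr_sub_sum => //; rewrite -bigcup_seq => w /= neq.
  apply: contrapT => H; apply: neq.
  have E i : slot p i (U w) = slot q i (U w).
    apply/eqP; apply: contrapT => /negP ne; apply: H.
    by exists i => //=; rewrite mem_index_enum.
  by apply: eq_pick => i; exact: E.
have : pr P [set w | sample p w != sample q w] <=
  (\sum_i `|p i - q i|) / N + (1 - N^-1) * pr P [set w | sample p w !=
    sample q w].
  rewrite -(pr_reject dp) -indep//.
  apply: le_trans (lerD H1 (lexx _)); rewrite -(pr_fst mA).
  apply: pr_subU => //.
  - exact: (measurable_preimage mf).
  - by apply: measurableI; [exact: (measurable_preimage mf)|exact: (measurable_preimage mg)].
  move=> w /=; rewrite !(sampleE _ w).
  have [<-|ne] := pselect (accept p (f w) = accept q (f w)); last by left.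
  by case: (accept p (f w)) => [j|]; [rewrite eqxx|right].
move=> H; have {}H : pr P [set w | sample p w != sample q w] * N^-1 <=
  (\sum_i `|p i - q i|) * N^-1 by lra.
by move: H; rewrite ler_pM2r// invr_gt0.
Qed.

End one_law.
End rejection_sampling.

(** * Sampling down a hierarchy of partitions *)

Section hierarchical_sampling.
Context (R : realType) (X : finType).
Implicit Types (p q : X -> R) (c : {ffun X -> X}).

Definition mass p : R := \sum_x p x.
Definition cell p c j : X -> R := fun x => if c x == j then p x else 0.

Lemma mass_ge0 p : (forall x, 0 <= p x) -> 0 <= mass p.
Proof. by move=> p0; rewrite sumr_ge0. Qed.

Lemma mass0_eq0 p x : (forall x, 0 <= p x) -> mass p = 0 -> p x = 0.
Proof.
move=> p0 m0; apply/eqP; rewrite eq_le p0 andbT -m0 /mass (bigD1 x)//= lerDl.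
by rewrite sumr_ge0.
Qed.

Lemma cell_ge0 p c j : (forall x, 0 <= p x) -> forall x, 0 <= cell p c j x.
Proof. by move=> p0 x; rewrite /cell; case: ifP. Qed.

Lemma sum_cell p c x : \sum_j cell p c j x = p x.
Proof.
rewrite (bigD1 (c x))//= /cell eqxx big1 ?addr0// => j.
by rewrite eq_sym => /negbTE ->.
Qed.

Lemma sum_mass_cell p c : \sum_j mass (cell p c j) = mass p.
Proof. by rewrite /mass exchange_big/=; apply: eq_bigr => x _;
  exact: sum_cell. Qed.

Lemma mass_cellB p q c j :
  mass (cell (p \- q) c j) = mass (cell p c j) - mass (cell q c j).
Proof.
by rewrite /mass -sumrB; apply: eq_bigr => x _; rewrite /cell; case: ifP;
  rewrite ?subr0.
Qed.

Lemma cellB p q c j : cell (p \- q) c j = cell p c j \- cell q c j.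
Proof. by apply/funext => x; rewrite /cell /=; case: ifP; rewrite ?subr0. Qed.

Lemma cellD p q c j : cell (p \+ q) c j = cell p c j \+ cell q c j.
Proof. by apply/funext => x; rewrite /cell /=; case: ifP; rewrite ?addr0. Qed.

Lemma dist_normalize (I : finType) (a : I -> R) : (forall i, 0 <= a i) ->
  0 < \sum_i a i -> dist (fun i => a i / \sum_i a i).
Proof.
move=> a0 s0; split; first by move=> i; rewrite divr_ge0// ltW.
by rewrite -mulr_suml divff// gt_eqF.
Qed.

Lemma dist_cells p c : (forall x, 0 <= p x) -> 0 < mass p ->
  dist (fun j => mass (cell p c j) / mass p).
Proof.
move=> p0 m0; rewrite -(sum_mass_cell p c); apply: dist_normalize.
  by move=> j; apply: mass_ge0; exact: cell_ge0.
by rewrite sum_mass_cell.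
Qed.

(** Conditioning on a cell divides by its mass, which can enlarge the difference
    of two laws without bound; a factor [m] that exceeds neither of the two masses
    compensates for this. *)
Lemma sum_normalize_diff (I : finType) (a b : I -> R) (m : R) :
  (forall i, 0 <= b i) -> 0 < m -> m <= \sum_i a i -> m <= \sum_i b i ->
  m * \sum_i `|a i / \sum_i a i - b i / \sum_i b i| <= 2 * \sum_i `|a i - b i|.
Proof.
move=> b0 m0; set A := \sum_i a i; set B := \sum_i b i => mA mB.
have A0 : 0 < A by apply: lt_le_trans mA.
have B0 : 0 < B by apply: lt_le_trans mB.
set D := \sum_i `|a i - b i|.
have AB : `|B - A| <= D.
  by rewrite distrC /A /B -sumrB; exact: ler_norm_sum.
have D0 : 0 <= D by rewrite sumr_ge0.
apply: (@le_trans _ _ (m / A * (D + `|B - A|))).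
  have -> : D + `|B - A| = \sum_i (`|a i - b i| + b i / B * `|B - A|).
    by rewrite big_split/= -!mulr_suml -/B divff ?mul1r ?gt_eqF.
  rewrite -mulrA ler_pM2l// mulr_sumr ler_sum// => i _.
  have -> : a i / A - b i / B = A^-1 * ((a i - b i) + b i / B * (B - A)).
    by field; rewrite !gt_eqF.
  rewrite normrM ger0_norm ?invr_ge0 ?(ltW A0)// ler_pM2l ?invr_gt0//.
  apply: le_trans (ler_normD _ _) _; rewrite lerD2l normrM ger0_norm//.
  by rewrite divr_ge0// ltW.
have mA1 : m / A <= 1 by rewrite ler_pdivrMr// mul1r.
have mA0 : 0 <= m / A by rewrite divr_ge0// ltW.
have : m / A * (D + `|B - A|) <= 1 * (D + `|B - A|)
  by rewrite ler_wpM2r// addr_ge0.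
lra.
Qed.

(* A level of a hierarchy is a partition, given by the function that labels each
   point by its cell, together with a bound on the diameter of the sets that
   this partition splits. *)
Implicit Type ls : seq (R * {ffun X -> X}).

(** For hierarchies whose diameters decrease geometrically, this is, up to a
    constant factor, the transportation norm of the tree of cells. *)
Fixpoint tree_norm ls (phi : X -> R) : R :=
  if ls is (D, c) :: ls' then
    2 * D * (\sum_j `|mass (cell phi c j)|) +
    \sum_j tree_norm ls' (cell phi c j)
  else 0.

Definition levels_ge0 ls := all (fun l => 0 <= l.1) ls.

Lemma tree_norm_ge0 ls phi : levels_ge0 ls -> 0 <= tree_norm ls phi.
Proof.
elim: ls phi => //= -[D c] ls IH phi /= /andP[D0 ls0].
by rewrite addr_ge0 ?mulr_ge0 ?sumr_ge0// => j _; exact: IH.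
Qed.

Lemma tree_normD ls phi psi : levels_ge0 ls ->
  tree_norm ls (phi \+ psi) <= tree_norm ls phi + tree_norm ls psi.
Proof.
elim: ls phi psi => [|[D c] ls IH] phi psi /=; first by rewrite addr0.
move=> /andP[D0 ls0]; rewrite addrACA lerD//.
  rewrite -mulrDr ler_wpM2l ?mulr_ge0// -big_split/= ler_sum// => j _.
  by rewrite cellD /mass /= big_split/=; exact: ler_normD.
by rewrite -big_split/= ler_sum// => j _; rewrite cellD IH.
Qed.

Lemma tree_normZ ls a phi :
  tree_norm ls (fun x => a * phi x) = `|a| * tree_norm ls phi.
Proof.
elim: ls phi => [|[D c] ls IH] phi /=; first by rewrite mulr0.
have E j : cell (fun x => a * phi x) c j = fun x => a * cell phi c j x.
  by apply/funext => x; rewrite /cell; case: ifP; rewrite ?mulr0.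
rewrite mulrDr; congr (_ + _).
  rewrite mulrCA; congr (_ * _); rewrite mulr_sumr; apply: eq_bigr => j _.
  by rewrite E /mass -mulr_sumr normrM.
by rewrite mulr_sumr; apply: eq_bigr => j _; rewrite E IH.
Qed.

Lemma tree_norm0 ls : tree_norm ls (fun=> 0) = 0.
Proof.
rewrite -[RHS](mul0r (tree_norm ls (fun=> 0))) -[X in _ =
  X * _](normr0 R) -tree_normZ.
by congr tree_norm; apply/funext => x; rewrite mul0r.
Qed.

Lemma tree_norm_sum ls (I : Type) (s : seq I) (a : I -> R) (phi : I -> X -> R) :
  levels_ge0 ls -> (forall i, 0 <= a i) ->
  tree_norm ls (fun x => \sum_(i <- s) a i * phi i x) <=
  \sum_(i <- s) a i * tree_norm ls (phi i).
Proof.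
move=> ls0 a0; elim: s => [|i s IH].
  rewrite big_nil (_ : (fun _ => _) = fun=> 0) ?tree_norm0//.
  by apply/funext => x; rewrite big_nil.
rewrite big_cons (_ : (fun _ => _) =
  (fun x => a i * phi i x) \+ (fun x => \sum_(j <- s) a j * phi j x));
    last first.
  by apply/funext => x; rewrite big_cons.
apply: le_trans (tree_normD _ _ ls0) _.
by rewrite tree_normZ ger0_norm// lerD2l.
Qed.

Definition sum_diam ls : R := \sum_(l <- ls) l.1.

Definition dirac_at (a : X) : X -> R := fun x => (x == a)%:R.

Lemma cell_dirac c a j :
  cell (dirac_at a) c j = if c a == j then dirac_at a else fun=> 0.
Proof.
apply/funext => x; rewrite /cell /dirac_at; have [->|xa] := eqVneq x a.
  by case: ifP => //; rewrite eqxx.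
by case: ifP; case: ifP => //; rewrite (negbTE xa).
Qed.

Lemma mass_dirac a : mass (dirac_at a) = 1.
Proof.
rewrite /mass (bigD1 a)//= /dirac_at eqxx big1 ?addr0// => x /negbTE ->.
by [].
Qed.

Lemma mass_zero : mass (fun=> 0) = 0.
Proof. by rewrite /mass big1. Qed.

Lemma tree_norm_dirac ls a : tree_norm ls (dirac_at a) = 2 * sum_diam ls.
Proof.
elim: ls => [|[D c] ls IH] /=; first by rewrite /sum_diam big_nil mulr0.
rewrite (bigD1 (c a))//= [X in _ + X](bigD1 (c a))//= !cell_dirac eqxx IH.
rewrite !big1 => [|j|j]; last 2 first.
- by rewrite eq_sym cell_dirac => /negbTE ->; rewrite tree_norm0.
- by rewrite eq_sym cell_dirac => /negbTE ->; rewrite mass_zero normr0.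
by rewrite mass_dirac /sum_diam big_cons normr1 /=; ring.
Qed.

(** When [a] and [b] separate at a level, the point masses at [a] and at [b] both
    contribute to the norm at this level and at all the levels below. *)
Fixpoint cut_cost ls (a b : X) : R :=
  if ls is (D, c) :: ls' then
    (c a != c b)%:R * (4 * (D + sum_diam ls')) + cut_cost ls' a b
  else 0.

Lemma sum_diam_ge0 ls : levels_ge0 ls -> 0 <= sum_diam ls.
Proof.
by elim: ls => [|l ls IH] /=;
  rewrite /sum_diam ?big_nil// big_cons => /andP[? /IH ?];
  rewrite addr_ge0.
Qed.

Lemma cut_cost_ge0 ls a b : levels_ge0 ls -> 0 <= cut_cost ls a b.
Proof.
elim: ls => [|[D c] ls IH] //= /andP[D0 ls0].
by rewrite addr_ge0 ?IH// !mulr_ge0// addr_ge0// sum_diam_ge0.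
Qed.

Lemma tree_norm_diracB ls a b : levels_ge0 ls ->
  tree_norm ls (dirac_at a \- dirac_at b) <= cut_cost ls a b.
Proof.
elim: ls => [|[D c] ls IH] // ls0; have /andP[D0 ls0'] := ls0.
have [cab|cab] := eqVneq (c a) (c b); last first.
  rewrite [cut_cost _ _ _]/= cab mul1r.
  apply: (@le_trans _ _ (4 * (D + sum_diam ls)));
    last by rewrite lerDl cut_cost_ge0.
  have -> : dirac_at a \- dirac_at b = dirac_at a \+ (fun x =>
    - 1 * dirac_at b x).
    by apply/funext => x /=; rewrite mulN1r.
  apply: le_trans (tree_normD _ _ ls0) _.
  rewrite tree_normZ normrN1 mul1r !tree_norm_dirac /sum_diam big_cons /=; lra.
rewrite /= cab eqxx mul0r add0r big1 ?mulr0 ?add0r; last first.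
  move=> j _; rewrite mass_cellB !cell_dirac cab; case: ifP => _.
    by rewrite !mass_dirac subrr normr0.
  by rewrite mass_zero subrr normr0.
rewrite (bigD1 (c b))//= big1 ?addr0; last first.
  move=> j; rewrite eq_sym => /negbTE jb; rewrite cellB !cell_dirac cab jb.
  by rewrite (_ : _ \- _ = fun=> 0) ?tree_norm0//; apply/funext => x /=;
    rewrite subrr.
by rewrite cellB !cell_dirac cab eqxx; exact: IH.
Qed.

Context (d : measure_display) (T : measurableType d).
Variables (P : probability T R) (f g : T -> T) (U : T -> R).
Hypothesis src : splits P f g U.
Let mf := measurable_split1 src.
Let mg := measurable_split2 src.

Variable x0 : X.
Variable dX : X -> X -> R.

Local Notation draw p := (sample f g U x0 p).
Local Notation draw_cell p c :=
  (sample f g U x0 (fun j => mass (cell p c j) / mass p)).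

(** The functions [f] and [g] provide the randomness of the current level and of
    the levels below.  They do not depend on [p], and this is what couples the
    descents of different laws. *)
Fixpoint descend ls p w : X :=
  if ls is (_, c) :: ls' then
    descend ls' (cell p c (draw_cell p c (f w))) (g w)
  else draw (fun x => p x / mass p) w.

Lemma rfin_descend ls p : rfin (descend ls p).
Proof.
elim: ls p => [|[D c] ls IH] p /=.
  exact: (rfin_sample src x0 (fun x => p x / mass p)).
have h1 := rfin_precomp (rfin_sample src x0 (fun j =>
  mass (cell p c j) / mass p)) mf.
have h2 := rfin_ffun (fun j => rfin_precomp (IH (cell p c j)) mg).
have := rfin_comp (fun jh : X * {ffun X -> X} => jh.2 jh.1) (rfin_pair h1 h2).
by congr rfin; apply/funext => w /=; rewrite ffunE.
Qed.

Lemma pr_descend ls p x : (forall x, 0 <= p x) -> 0 < mass p ->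
  pr P [set w | descend ls p w = x] = p x / mass p.
Proof.
elim: ls p => [|[D c] ls IH] p p0 m0.
  by rewrite /= (pr_sample src)//; exact: dist_normalize.
have dc := dist_cells c p0 m0.
have mS := rfin_sample src x0 (fun j => mass (cell p c j) / mass p).
have mD := rfin_precomp mS mf.
rewrite (pr_total P mD); last exact: rfin_descend.
transitivity (\sum_j cell p c j x / mass p);
  last by rewrite -mulr_suml sum_cell.
apply: eq_bigr => j _.
have -> : [set w | descend ((D, c) :: ls) p w = x] `&`
  [set w | draw_cell p c (f w) = j] =
  f @^-1` [set w | draw_cell p c w = j] `&`
    g @^-1` [set w | descend ls (cell p c j) w = x].
  by apply/seteqP; split => w /= [h1 h2]; split => //; move: h1 h2 => /=;
    congruence.
rewrite (split_indep src); [|exact: (mS j)|exact: rfin_descend].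
rewrite (pr_sample src)//.
have [mj|mj] := eqVneq (mass (cell p c j)) 0.
  by rewrite mj mul0r mul0r (mass0_eq0 _ _ mj) ?mul0r//; exact: cell_ge0.
rewrite IH; [|exact: cell_ge0|].
  by field; rewrite mj gt_eqF.
by rewrite lt_neqAle eq_sym mj mass_ge0//; exact: cell_ge0.
Qed.

Definition mean_cost ls p q : R :=
  \sum_x \sum_y
    dX x y * pr P [set w | descend ls p w = x /\ descend ls q w = y].

Let measurable_joint ls p q x y :
  measurable [set w | descend ls p w = x /\ descend ls q w = y].
Proof.
exact: (rfin_pred (fun xy => xy.1 = x /\ xy.2 = y)
  (rfin_pair (rfin_descend ls p) (rfin_descend ls q))).
Qed.

Lemma pr_joint_sum (I J : finType) (Z : T -> I) (Y : T -> J) :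
  rfin Z -> rfin Y ->
  \sum_i \sum_j pr P [set w | Z w = i /\ Y w = j] = 1.
Proof.
move=> mZ mY; rewrite -(pr_setT P) (pr_total P mZ measurableT).
by apply: eq_bigr => i _; rewrite setTI (pr_total P mY (mZ i)).
Qed.

(** A descent stays in the support of its law. *)
Lemma mean_cost_diam ls p q (D : R) :
  (forall x, 0 <= p x) -> (forall x, 0 <= q x) -> 0 < mass p -> 0 < mass q ->
  (forall x y, p x != 0 -> q y != 0 -> dX x y <= D) ->
  mean_cost ls p q <= D.
Proof.
move=> p0 q0 mp mq HD.
rewrite -[leRHS]mulr1 -(pr_joint_sum (rfin_descend ls p) (rfin_descend ls q)).
rewrite mulr_sumr ler_sum// => x _; rewrite mulr_sumr ler_sum// => y _.
have [px|px] := eqVneq (p x) 0.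
  suff -> : pr P [set w | descend ls p w = x /\ descend ls q w = y] =
    0 by rewrite !mulr0.
  apply/eqP; rewrite eq_le pr_ge0 andbT.
  have <- : pr P [set w | descend ls p w = x] = 0
    by rewrite pr_descend// px mul0r.
  by apply: le_pr => //; [exact: rfin_descend|move=> w []].
have [qy|qy] := eqVneq (q y) 0.
  suff -> : pr P [set w | descend ls p w = x /\ descend ls q w = y] =
    0 by rewrite !mulr0.
  apply/eqP; rewrite eq_le pr_ge0 andbT.
  have <- : pr P [set w | descend ls q w = y] = 0
    by rewrite pr_descend// qy mul0r.
  by apply: le_pr => //; [exact: rfin_descend|move=> w []].
by rewrite ler_wpM2r ?pr_ge0// HD.
Qed.

(** Given the cells drawn at the first level, the two descents continue with
    randomness that is independent of these cells. *)
Lemma mean_cost_cons D c ls p q :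
  mean_cost ((D, c) :: ls) p q = \sum_i \sum_j
    pr P [set w | draw_cell p c w = i /\ draw_cell q c w = j] *
    mean_cost ls (cell p c i) (cell q c j).
Proof.
have mS p' := rfin_sample src x0 (fun j => mass (cell p' c j) / mass p').
have mJ := rfin_pair (mS p) (mS q).
have mJf := rfin_precomp mJ mf.
under [RHS]eq_bigr do under eq_bigr do rewrite mulr_sumr.
rewrite pair_big_dep/= exchange_big/=; apply: eq_bigr => x _.
under [RHS]eq_bigr do rewrite mulr_sumr.
rewrite exchange_big/=; apply: eq_bigr => y _.
rewrite (pr_total P mJf (measurable_joint ((D, c) :: ls) p q x y)) mulr_sumr.
apply: eq_bigr => -[i j] _ /=.
rewrite mulrCA; congr (_ * _).
have mI : measurable [set w | draw_cell p c w = i /\ draw_cell q c w = j].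
  exact: (rfin_pred (fun xy => xy.1 = i /\ xy.2 = j) mJ).
rewrite -(split_indep src)//.
congr pr; apply/seteqP; split => w /=.
  by move=> [[h1 h2] [h3 h4]]; rewrite h3 in h1; rewrite h4 in h2.
by move=> [[-> ->] []].
Qed.

(** The bounds attached to the levels are correct for the cells inside [S], and
    the finest cells have diameter zero. *)
Fixpoint diam_levels ls (S : pred X) : Prop :=
  if ls is (D, c) :: ls' then
    (forall x y, S x -> S y -> dX x y <= D) /\
    forall j, diam_levels ls' [pred x | S x & c x == j]
  else forall x y, S x -> S y -> dX x y <= 0.

(** The weight [m] makes the induction work.  At a cell [i] the hypothesis is
    used with [m] times the probability that both laws draw [i], which is at most
    the mass that each of them gives to [i]. *)
Lemma le_tree_norm ls (S : pred X) p q (m : R) :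
  levels_ge0 ls -> diam_levels ls S ->
  (forall x, 0 <= p x) -> (forall x, 0 <= q x) ->
  (forall x, p x != 0 -> S x) -> (forall x, q x != 0 -> S x) ->
  0 <= m -> m <= mass p -> m <= mass q ->
  m * mean_cost ls p q <= tree_norm ls (p \- q).
Proof.
elim: ls S p q m => [|[D c] ls IH] S p q m ls0 dS p0 q0 pS qS m0 mp mq.
  move: m0; rewrite le_eqVlt => /predU1P[<-|m0]; first by rewrite mul0r.
  rewrite pmulr_rle0//; apply: mean_cost_diam => //.
  - exact: lt_le_trans mp.
  - exact: lt_le_trans mq.
  - by move=> x y /pS Sx /qS Sy; exact: dS.
move: m0; rewrite le_eqVlt => /predU1P[<-|m0];
  first by rewrite mul0r tree_norm_ge0.
have mp0 : 0 < mass p by apply: lt_le_trans mp.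
have mq0 : 0 < mass q by apply: lt_le_trans mq.
have [/= HD HS] := dS; have /andP[/= D0 ls0'] := ls0.
have dp := dist_cells c p0 mp0; have dq := dist_cells c q0 mq0.
have mS p' := rfin_sample src x0 (fun j => mass (cell p' c j) / mass p').
have mJ := rfin_pair (mS p) (mS q).
have mI i j : measurable [set w | draw_cell p c w = i /\ draw_cell q c w = j].
  exact: (rfin_pred (fun xy => xy.1 = i /\ xy.2 = j) mJ).
pose k i j := pr P [set w | draw_cell p c w = i /\ draw_cell q c w = j].
have kp i j : k i j <= mass (cell p c i) / mass p.
  by rewrite -(pr_sample src x0 _ dp); apply: le_pr => // [|w []//];
    exact: (mS p i).
have kq i j : k i j <= mass (cell q c j) / mass q.
  by rewrite -(pr_sample src x0 _ dq); apply: le_pr => // [|w []//];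
    exact: (mS q j).
have k0 i j : 0 <= k i j by exact: pr_ge0.
have -> : mean_cost ((D, c) :: ls) p q =
    \sum_i \sum_j k i j * mean_cost ls (cell p c i) (cell q c j).
  exact: mean_cost_cons.
apply: (@le_trans _ _ (m * (D * \sum_i \sum_(j | j != i) k i j +
    \sum_i k i i * mean_cost ls (cell p c i) (cell q c i)))).
  rewrite ler_pM2l// mulr_sumr -big_split/= ler_sum// => i _.
  rewrite (bigD1 i)//= addrC lerD2r mulr_sumr ler_sum// => j ji.
  have [->|kij] := eqVneq (k i j) 0; first by rewrite mul0r mulr0.
  have kij0 : 0 < k i j by rewrite lt_neqAle eq_sym kij k0.
  rewrite mulrC ler_pM2r//; apply: mean_cost_diam;
    [exact: cell_ge0|exact: cell_ge0| | |].
  - by have := lt_le_trans kij0 (kp i j); rewrite pmulr_lgt0// invr_gt0.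
  - by have := lt_le_trans kij0 (kq i j); rewrite pmulr_lgt0// invr_gt0.
  - move=> x y; rewrite /cell; case: ifP; rewrite ?eqxx// => _; case: ifP;
      rewrite ?eqxx// => _.
    by move=> /pS Sx /qS Sy; exact: HD.
rewrite mulrDr /= lerD//.
  rewrite mulrCA [2 * D]mulrC -mulrA ler_wpM2l//.
  have -> : \sum_i \sum_(j | j != i) k i j = pr P [set w | draw_cell p c w !=
    draw_cell q c w].
    rewrite (pr_total P (mS p)); last first.
      exact: (rfin_pred (fun xy => xy.1 != xy.2) mJ).
    apply: eq_bigr => i _; rewrite (pr_total P (mS q)); last first.
      by apply: measurableI (mS p i);
        exact: (rfin_pred (fun xy => xy.1 != xy.2) mJ).
    rewrite [RHS](bigD1 i)//= (_ : _ `&` _ = set0) ?pr_set0 ?add0r; last first.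
      by apply/seteqP; split => w //= -[[+ h1] h2]; rewrite h1 h2 eqxx.
    apply: eq_bigr => j ji; congr pr; apply/seteqP; split => w /=.
      by move=> [h1 h2]; rewrite h1 h2 eq_sym.
    by move=> [[_ ->] ->].
  apply: (@le_trans _ _ (m * \sum_i `|mass (cell p c i) / mass p - mass (cell q
    c i) / mass q|)).
    by rewrite ler_pM2l//; exact: (pr_sample_neq src).
  under [in leRHS]eq_bigr do rewrite mass_cellB.
  have := @sum_normalize_diff _ (fun i => mass (cell p c i)) (fun i =>
    mass (cell q c i)) m.
  rewrite !sum_mass_cell; apply => //.
  by move=> i; apply: mass_ge0; exact: cell_ge0.
rewrite mulr_sumr ler_sum// => i _; rewrite mulrA cellB.
apply: (IH [pred x | S x & c x == i] _ _ _ ls0' (HS i)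
  (cell_ge0 c i p0) (cell_ge0 c i q0)).
- by move=> x /=; rewrite /cell; case: ifP; rewrite ?eqxx ?andbT// => _;
    exact: pS.
- by move=> x /=; rewrite /cell; case: ifP; rewrite ?eqxx ?andbT// => _;
    exact: qS.
- by rewrite mulr_ge0// ltW.
- apply: (@le_trans _ _ (m * (mass (cell p c i) / mass p)));
    first by rewrite ler_pM2l.
  rewrite mulrCA ler_piMr//; first by apply: mass_ge0; exact: cell_ge0.
  by rewrite ler_pdivrMr// mul1r.
- apply: (@le_trans _ _ (m * (mass (cell q c i) / mass q)));
    first by rewrite ler_pM2l.
  rewrite mulrCA ler_piMr//; first by apply: mass_ge0; exact: cell_ge0.
  by rewrite ler_pdivrMr// mul1r.
Qed.

(** The seminorm of [p - q] is bounded by averaging over the coupling [gamma]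
    the seminorms of differences of point masses. *)
Lemma mean_cost_coupling ls p q (gamma : X -> X -> R) :
  levels_ge0 ls -> diam_levels ls predT -> dist p -> dist q ->
  (forall x y, 0 <= gamma x y) ->
  (forall x, \sum_y gamma x y = p x) -> (forall y, \sum_x gamma x y = q y) ->
  mean_cost ls p q <= \sum_x \sum_y gamma x y * cut_cost ls x y.
Proof.
move=> ls0 dls [p0 p1] [q0 q1] g0 gp gq.
have := @le_tree_norm ls predT p q 1 ls0 dls p0 q0.
rewrite mul1r => H; apply: le_trans (H _ _ _ _ _) _ => //;
  [by rewrite /mass p1|by rewrite /mass q1|].
have -> : p \- q = fun z => \sum_(xy :
  X * X) gamma xy.1 xy.2 * (dirac_at xy.1 \- dirac_at xy.2) z.
  apply/funext => z /=; rewrite -gp -gq; under [RHS]eq_bigr do rewrite mulrBr.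
  rewrite sumrB; congr (_ - _).
    rewrite -(pair_bigA _ (fun x y => gamma x y * dirac_at x z))/=.
    rewrite [RHS](bigD1 z)//= [X in _ + X]big1 ?addr0; last first.
      by move=> x xz; rewrite big1// => y _;
        rewrite /dirac_at eq_sym (negbTE xz) mulr0.
    by apply: eq_bigr => y _; rewrite /dirac_at eqxx mulr1.
  rewrite -(pair_bigA _ (fun x y => gamma x y * dirac_at y z))/=.
  apply: eq_bigr => x _; rewrite (bigD1 z)//= /dirac_at eqxx mulr1 big1 ?addr0// => y yz.
  by rewrite eq_sym (negbTE yz) mulr0.
rewrite pair_bigA/=; apply: le_trans (tree_norm_sum _ _ _ _) _ => //.
by apply: ler_sum => xy _; rewrite ler_wpM2l// tree_norm_diracB.
Qed.

End hierarchical_sampling.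

(** * Harmonic sums and random priorities *)

Definition harmonic_number (R : realType) n : R := \sum_(i < n) i.+1%:R^-1.

(** Without ties, the denominators are [1, ..., n]; ties only enlarge them. *)
Lemma sum_inv_rank (R : realType) (X : finType) (m : X -> R) :
  \sum_v (#|[pred u | m u <= m v]|%:R)^-1 <= harmonic_number R #|X|.
Proof.
suff H (S : {set X}) : \sum_(v in S) (#|[pred u | (u \in S) && (m u <=
  m v)]|%:R)^-1 <=
    harmonic_number R #|S|.
  have := H [set: X]%SET; rewrite cardsT; apply: le_trans.
  rewrite le_eqVlt; apply/orP; left; apply/eqP; apply: eq_big => [v|v _];
    first by rewrite inE.
  by congr (_%:R^-1); apply: eq_card => u; rewrite !inE.
elim: {S}#|S| {-2}S (erefl #|S|) => [|n IH] S cS.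
  by rewrite (cards0_eq cS) cards0 big_set0 /harmonic_number big_ord0.
have [y yS] : exists y, y \in S by apply/card_gt0P; rewrite cS.
pose z := [arg max_(v > y in S) m v]%O.
have [zS zmax] : z \in S /\ forall u, u \in S -> m u <= m z.
  by rewrite /z; case: arg_maxP.
rewrite (big_setD1 z)//= cS /harmonic_number big_ord_recr/= addrC lerD//.
  have cS' : #|S :\ z| = n by apply/eqP; rewrite -eqSS -cS (cardsD1 z S) zS.
  have := IH _ cS'; rewrite cS'; apply: le_trans; apply: ler_sum => v;
    rewrite !inE => /andP[vz vS].
  rewrite lef_pV2 ?posrE ?ltr0n ?ler_nat; last 2 first.
  - by apply/card_gt0P; exists v; rewrite inE vS lexx.
  - by apply/card_gt0P; exists v; rewrite !inE vz vS lexx.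
  by apply/subset_leq_card/fintype.subsetP => u;
    rewrite !inE => /andP[/andP[_ ->]].
rewrite lef_pV2 ?posrE ?ltr0n// -?cS.
  rewrite ler_nat subset_leq_card//; apply/fintype.subsetP => u uS.
  by rewrite inE uS zmax.
by apply/card_gt0P; exists z; rewrite inE zS lexx.
Qed.

Section random_priority.
Context (X : finType).
Implicit Types (s : {perm X}) (A : {set X}) (N : {ffun X * X -> bool}).

Definition priority s (x : X) : nat := enum_rank (s x).

Lemma priority_inj s : injective (priority s).
Proof. by move=> x y /val_inj/enum_rank_inj/perm_inj. Qed.

(** The orders of priority in which [v] comes first among the points of [A]. *)
Definition leaders A (v : X) : {set {perm X}} :=
  finset.finset (fun s => [forall u in A, (priority s v <= priority s u)%N]).

Lemma card_leaders A u v : u \in A -> v \in A ->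
  (#|leaders A u| <= #|leaders A v|)%N.
Proof.
move=> uA vA; rewrite -(card_imset _ (mulgI (tperm u v))) subset_leq_card//.
apply/fintype.subsetP => _ /imsetP[s + ->]; rewrite !inE => /forall_inP H.
apply/forall_inP => w wA; rewrite /priority !permM tpermR.
by apply: H; case: tpermP.
Qed.

(** Each order has at most one leader in [A], and exchanging two points of [A]
    shows that all of them lead equally often. *)
Lemma leaders_bound A v : v \in A -> (#|A| * #|leaders A v| <= #|{perm X}|)%N.
Proof.
move=> vA; rewrite -sum_nat_const.
apply: (@leq_trans (\sum_(u in A) #|leaders A u|)).
  by apply: leq_sum => u uA; exact: card_leaders.
under eq_bigr do rewrite -sum1_card big_mkcond.
rewrite exchange_big/= -sum1_card leq_sum// => s _.
rewrite -big_mkcondr sum1_card; apply/card_le1_eqP => x y /andP[xA + /andP[yA]].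
rewrite !inE => /forall_inP Hx /forall_inP Hy.
by apply: (@priority_inj s); apply/eqP; rewrite eqn_leq Hx// Hy.
Qed.

(** [N (v, x)] means that [v] may serve as the center of [x].  The default
    center is [x] itself. *)
Definition first_near s N (x : X) : X :=
  arg_min x (fun v => N (v, x)) (priority s).

Lemma first_nearP s N x : N (x, x) ->
  N (first_near s N x, x) /\
  forall v, N (v, x) ->
    (priority s (first_near s N x) <= priority s v)%N.
Proof. by move=> Nx; rewrite /first_near; case: arg_minnP. Qed.

(** The point of highest priority near [x] or [y] is the center of every one of
    the two that it is near to.  So it separates them only if it is near to
    exactly one. *)
Lemma first_near_split s N x y : N (x, x) -> N (y, y) ->
  first_near s N x != first_near s N y ->
  exists v, N (v, x) (+) N (v, y) /\
    forall u, N (u, x) || N (u, y) -> (priority s v <= priority s u)%N.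
Proof.
move=> Nx Ny cxy; have [cx Hx] := first_nearP s Nx;
  have [cy Hy] := first_nearP s Ny.
have [le|lt] := leqP (priority s (first_near s N x)) (priority s (first_near s N y)).
  exists (first_near s N x); rewrite cx; split.
    rewrite addTb; apply: contra cxy => /Hy H; apply/eqP/(@priority_inj s)/eqP.
    by rewrite eqn_leq le.
  by move=> u /orP[/Hx//|/Hy]; exact: leq_trans.
exists (first_near s N y); rewrite cy; split.
  rewrite addbT; apply: contra cxy => /Hx H; apply/eqP/(@priority_inj s)/eqP.
  by rewrite eqn_leq H ltnW.
by move=> u /orP[/Hx|/Hy//]; apply: leq_trans; exact: ltnW.
Qed.

End random_priority.

Section clamp_theory.
Context (R : realType).
Implicit Types a b c x y : R.

Lemma clampP a b x : a <= b ->
  [\/ x <= a /\ clamp a b x = a, a <= x <= b /\ clamp a b x = x |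
      b <= x /\ clamp a b x = b].
Proof.
move=> ab; rewrite /clamp; have [xa|ax] := leP x a.
  by constructor 1; rewrite (min_idPr ab).
have [xb|bx] := leP x b; first by constructor 2; rewrite (ltW ax).
by constructor 3; rewrite ltW.
Qed.

Lemma clamp_split a b c x : a <= b -> b <= c ->
  clamp a c x + b = clamp a b x + clamp b c x.
Proof.
move=> ab bc; have ac := le_trans ab bc.
by case: (clampP x ab) => [[? ->]|[/andP[? ?] ->]|[? ->]];
  case: (clampP x bc) => [[? ->]|[/andP[? ?] ->]|[? ->]];
  case: (clampP x ac) => [[? ->]|[/andP[? ?] ->]|[? ->]]; lra.
Qed.

Lemma clampB_le a b x y : a <= b -> x <= y ->
  clamp a b y - clamp a b x <= y - x.
Proof.
move=> ab xy.
by case: (clampP x ab) => [[? ->]|[/andP[? ?] ->]|[? ->]];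
  case: (clampP y ab) => [[? ->]|[/andP[? ?] ->]|[? ->]]; lra.
Qed.

Lemma le_clamp a b x y : a <= b -> x <= y -> clamp a b x <= clamp a b y.
Proof.
move=> ab xy.
by case: (clampP x ab) => [[? ->]|[/andP[? ?] ->]|[? ->]];
  case: (clampP y ab) => [[? ->]|[/andP[? ?] ->]|[? ->]]; lra.
Qed.

Lemma clamp_range a b x : a <= b -> a <= clamp a b x <= b.
Proof.
by move=> ab; case: (clampP x ab) => [[? ->]|[/andP[? ?] ->]|[? ->]];
  rewrite ?lexx ?ab//; apply/andP.
Qed.

End clamp_theory.

(** * The random hierarchy *)

Section random_decomposition.
Context (R : realType) (X : finType) (dX : X -> X -> R).
Hypothesis dX_ge0 : forall x y, 0 <= dX x y.
Hypothesis dXx : forall x, dX x x = 0.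
Hypothesis dXC : forall x y, dX x y = dX y x.
Hypothesis dX_triangle : forall y x z, dX x z <= dX x y + dX y z.

Variable top : R.
Hypothesis top_gt0 : 0 < top.

Definition scale (l : nat) : R := top * 3^-1 ^+ l.

Lemma scale_gt0 l : 0 < scale l.
Proof. by rewrite mulr_gt0// exprn_gt0. Qed.

Lemma scaleS l : scale l.+1 = scale l / 3.
Proof. by rewrite /scale exprS; ring. Qed.

Implicit Type N : nat -> {ffun X * X -> bool}.

Definition levels (s : {perm X}) N k n : seq (R * {ffun X -> X}) :=
  [seq (18 * scale l, [ffun x => first_near s (N l) x]) | l <- iota k n].

Lemma levels_nonneg s N k n : levels_ge0 (levels s N k n).
Proof.
by apply/allP => _ /mapP[l _ ->] /=; rewrite mulr_ge0// ltW// scale_gt0.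
Qed.

(** Geometric sum: [18 * (1 + 1/3 + 1/9 + ...) = 27]. *)
Lemma sum_diam_levels s N k n : sum_diam (levels s N k n) <= 27 * scale k.
Proof.
elim: n k => [|n IH] k; first
  by rewrite /sum_diam big_nil mulr_ge0// ltW// scale_gt0.
rewrite /levels /= /sum_diam big_cons -/(sum_diam _) /=.
by have := IH k.+1; rewrite scaleS /levels; lra.
Qed.

Lemma cut_cost_levels s N k n x y : cut_cost (levels s N k n) x y <=
  \sum_(l <- iota k n)
    (first_near s (N l) x != first_near s (N l) y)%:R * (108 * scale l).
Proof.
elim: n k => [|n IH] k; first by rewrite big_nil.
rewrite [levels _ _ _ _]/= big_cons [cut_cost _ _ _]/= !ffunE; apply: lerD;
  last exact: IH.
rewrite ler_wpM2l//; have := sum_diam_levels s N k.+1 n;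
  rewrite scaleS /levels; lra.
Qed.

(** Points with the same center are within twice the radius, hence at most
    [6 * scale k = 18 * scale k.+1] apart. *)
Lemma diam_levels_levels s N K n k (S : pred X) :
  (forall l u x, (l < K)%N -> N l (u, x) -> dX u x <= 3 * scale l) ->
  (forall l x, (l < K)%N -> N l (x, x)) ->
  (forall x y, dX x y <= 18 * scale K -> dX x y <= 0) ->
  (k + n)%N = K -> (forall x y, S x -> S y -> dX x y <= 18 * scale k) ->
  diam_levels dX (levels s N k n) S.
Proof.
move=> Nd Nx small; elim: n k S => [|n IH] k S /=.
  by rewrite addn0 => -> H x y Sx Sy; apply: small; exact: H.
rewrite addnS => kn HS; split=> // j; apply: IH; first by rewrite addSn.
move=> x y /andP[_ /eqP xj] /andP[_ /eqP yj].
move: xj yj; rewrite !ffunE => xj yj.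
have kK : (k < K)%N by rewrite -kn ltnS leq_addr.
have [/(Nd _ _ _ kK) + _] := first_nearP s (Nx k x kK).
have [/(Nd _ _ _ kK) + _] := first_nearP s (Nx k y kK).
by rewrite xj yj scaleS; have := dX_triangle j x y; rewrite (dXC x j); lra.
Qed.

Context (d : measure_display) (T : measurableType d).
Variables (P : probability T R) (f g : T -> T) (U : T -> R).
Hypothesis src : splits P f g U.
Let mf := measurable_split1 src.
Let mg := measurable_split2 src.

Lemma pr_pred (I : finType) (Z : T -> I) (Q : pred I) : rfin Z ->
  pr P [set w | Q (Z w)] = \sum_i pr P [set w | Z w = i] * (Q i)%:R.
Proof.
move=> mZ; rewrite (pr_total P mZ (rfin_pred (fun i => Q i) mZ)).
apply: eq_bigr => i _; case Qi : (Q i).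
  by rewrite mulr1; congr pr; apply/seteqP; split=> w /=; [case|move=> ->].
by rewrite mulr0 (_ : _ `&` _ = set0) ?pr_set0//; apply/seteqP;
  split=> w //= -[+ h];
  rewrite h Qi.
Qed.

Definition uniform_perm : {perm X} -> R := fun=> #|{perm X}|%:R^-1.

Let card_perm_gt0 : 0 < #|{perm X}|%:R :> R.
Proof. by rewrite ltr0n; apply/card_gt0P; exists 1%g. Qed.

Lemma dist_uniform_perm : dist uniform_perm.
Proof.
split; first by move=> s; rewrite invr_ge0.
by rewrite sumr_const -[_ *+ _]mulr_natl divff// gt_eqF.
Qed.

Definition random_perm : T -> {perm X} := sample f g U 1%g uniform_perm.

Lemma rfin_random_perm : rfin random_perm.
Proof. exact: (rfin_sample src). Qed.

Lemma pr_leaders (A : {set X}) v : v \in A ->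
  pr P [set w | random_perm w \in leaders A v] <= #|A|%:R^-1.
Proof.
move=> vA; rewrite (pr_pred (mem (leaders A v)) rfin_random_perm).
under eq_bigr do rewrite (pr_sample src _ _ dist_uniform_perm).
rewrite -mulr_sumr /uniform_perm -natr_sum.
have A0 : 0 < #|A|%:R :> R by rewrite ltr0n; apply/card_gt0P; exists v.
rewrite ler_pdivrMl// ler_pdivlMr// -natrM ler_nat mulnC.
apply: leq_trans (leaders_bound vA); rewrite leq_mul2l; apply/orP; right.
by rewrite -sum1_card [leqRHS]big_mkcond/= leq_sum// => s _; case: (s \in _).
Qed.

Variable K : nat.

(** The radius enters only through the relation of being near at each level,
    which takes finitely many values.  So the hierarchy is a random element of
    a finite type. *)
Definition nearby (w : T) : {ffun 'I_K.+1 -> {ffun X * X -> bool}} :=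
  [ffun l : 'I_K.+1 => [ffun xy => dX xy.1 xy.2 <= scale l * (1 + 2 * U w)]].

(** The levels in use are below [K]; out of range, [inord] gives level [0]. *)
Definition nearness (h : {ffun 'I_K.+1 -> {ffun X * X -> bool}}) :
  nat -> {ffun X * X -> bool} := fun l => h (inord l).

Lemma rfin_nearby : rfin nearby.
Proof.
apply: rfin_ffun => l; apply: rfin_ffun => xy.
apply: (rfin_bool (B := ~` [set w | scale l * (1 + 2 * U w) < dX xy.1 xy.2])).
  by move=> w /=; rewrite leNgt; split => /negP.
apply: measurableC; apply: measurable_lt; apply: measurable_funM => //.
by apply: measurable_funD => //; apply: measurable_funM => //;
  exact: measurable_uniform src.
Qed.

Definition decomposition w :
    {perm X} * {ffun 'I_K.+1 -> {ffun X * X -> bool}} :=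
  (random_perm (f w), nearby (g w)).

Lemma rfin_decomposition : rfin decomposition.
Proof.
exact: rfin_pair (rfin_precomp rfin_random_perm mf) (rfin_precomp rfin_nearby mg).
Qed.

Definition decomposition_levels z := levels z.1 (nearness z.2) 0 K.

Let shell l (a : R) := clamp (scale l) (3 * scale l) a.

(** The radius [scale l * (1 + 2 * U)] is uniform on an interval of length
    [2 * scale l]. *)
Lemma pr_radius l a b : a <= b ->
  pr P [set w | a <= scale l * (1 + 2 * U w) < b] <=
  (shell l b - shell l a) / (2 * scale l).
Proof.
move=> ab; have s0 := scale_gt0 l; have s2 : 0 < 2 * scale l by lra.
have ss : scale l <= 3 * scale l by lra.
have /andP[a1 a2] := clamp_range a ss; have /andP[b1 b2] := clamp_range b ss.
have ab' := le_clamp ss ab;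
  rewrite -/(shell l a) -/(shell l b) in a1 a2 b1 b2 ab'.
have -> : (shell l b - shell l a) / (2 * scale l) =
   (shell l b - scale l) / (2 * scale l) - (shell l a - scale l) / (2 * scale l).
  by field; rewrite gt_eqF.
rewrite -(@uniform_pr _ _ _ _ _ _ _ src ((shell l a - scale l) / (2 * scale l))
  ((shell l b - scale l) / (2 * scale l))); last 3 first.
- by rewrite divr_ge0//; lra.
- by rewrite ler_pM2r ?invr_gt0//; lra.
- by rewrite ler_pdivrMr//; lra.
have mr (h : T -> R) u v : measurable_fun setT h -> measurable [set w | u <=
  h w < v].
  move=> mh; rewrite (_ : [set _ | _] = h @^-1` `[u, v[).
    exact: (measurable_preimage mh).
  by apply/seteqP; split=> w /=; rewrite in_itv.
have mU := measurable_uniform src.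
apply: le_pr; [|exact: mr|].
  by apply: mr; apply: measurable_funM => //; apply: measurable_funD => //;
    apply: measurable_funM.
move=> w /= /andP[wa wb]; have /andP[u0 u1] := unit_range src w.
rewrite ler_pdivrMr// ltr_pdivlMr//.
have us : 0 <= U w * scale l by rewrite mulr_ge0// ltW.
have us' : U w * scale l < scale l by rewrite gtr_pMl.
apply/andP; split.
  by rewrite /shell; case: (clampP a ss) => [[? ->]|[/andP[? ?] ->]|[? ->]];
    lra.
by rewrite /shell; case: (clampP b ss) => [[? ->]|[/andP[? ?] ->]|[? ->]]; lra.
Qed.

Let near_dist x y v := Num.min (dX v x) (dX v y).
Let far_dist x y v := Num.max (dX v x) (dX v y).

(** The two factors bound the probability that [v] has the highest priority among
    the points at least as close to the pair as [v], and the probability that the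
    radius lies between the two distances from [v]. *)
Lemma pr_cut l x y : (l <= K)%N ->
  pr P [set w |
    first_near (decomposition w).1 (nearness (decomposition w).2 l) x !=
    first_near (decomposition w).1 (nearness (decomposition w).2 l) y] <=
  \sum_v #|[pred u | near_dist x y u <= near_dist x y v]|%:R^-1 *
    ((shell l (far_dist x y v) - shell l (near_dist x y v)) / (2 * scale l)).
Proof.
move=> lK; pose A v := finset.finset (fun u => near_dist x y u <=
  near_dist x y v).
have vA v : v \in A v by rewrite inE lexx.
pose E v := [set w | random_perm w \in leaders (A v) v].
pose F v := [set w | near_dist x y v <= scale l * (1 +
  2 * U w) < far_dist x y v].
have mE v : measurable (E v).
  exact: (rfin_pred (fun s => s \in leaders (A v) v) rfin_random_perm).
have mF v : measurable (F v).
  rewrite /F (_ : [set _ | _] = (fun w => scale l * (1 + 2 * U w)) @^-1`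
      `[near_dist x y v, far_dist x y v[).
    apply: measurable_preimage => //.
    by apply: measurable_funM => //; apply: measurable_funD => //;
      apply: measurable_funM => //; exact: measurable_uniform src.
  by apply/seteqP; split=> w /=; rewrite in_itv.
apply: (@le_trans _ _ (\sum_v pr P (f @^-1` E v `&` g @^-1` F v))).
  apply: pr_sub_sum.
  - exact: (rfin_pred (fun z => first_near z.1 (nearness z.2 l) x !=
      first_near z.1 (nearness z.2 l) y)
      rfin_decomposition).
  - by move=> v; apply: measurableI;
      [exact: (measurable_preimage mf)|exact: (measurable_preimage mg)].
  rewrite -bigcup_seq => w /= cut.
  have NE : nearness (nearby (g w)) l =
      [ffun xy => dX xy.1 xy.2 <= scale l * (1 + 2 * U (g w))].
    by rewrite /nearness /nearby ffunE inordK.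
  have := @first_near_split X (random_perm (f w)) (nearness (nearby (g w)) l) x y.
  have /andP[u0 u1] := unit_range src (g w).
  have r0 : 0 <= scale l * (1 + 2 * U (g w)).
    by rewrite mulr_ge0 ?(ltW (scale_gt0 l))//; lra.
  move: cut; rewrite NE => cut /(_ _ _ cut) []; rewrite ?ffunE/= ?dXx// => v [].
  rewrite !ffunE/= => xorv Hv; exists v; first by rewrite /= mem_index_enum.
  split; rewrite /E /F /=.
    rewrite inE; apply/forall_inP => u; rewrite inE => uv; apply: Hv.
    rewrite !ffunE/= -ge_min; apply: le_trans uv _.
    rewrite /near_dist ge_min; move: xorv.
    by case: (dX v x <= _) => //=; rewrite addFb.
  rewrite /near_dist /far_dist ge_min lt_max !ltNge; move: xorv.
  by case: (dX v x <= _); case: (dX v y <= _).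
apply: ler_sum => v _; rewrite (split_indep src)//.
apply: ler_pM; rewrite ?pr_ge0//.
  have := pr_leaders (vA v).
  by rewrite (_ : #|A v| = #|[pred u | near_dist x y u <=
    near_dist x y v]|)// cardsE.
apply: pr_radius; rewrite /near_dist /far_dist.
by rewrite ge_min !le_max !lexx.
Qed.

(** The ranges of the radius at consecutive levels are adjacent intervals. *)
Lemma sum_shells n a b : \sum_(0 <= l < n) (shell l b - shell l a) =
  clamp (3 * scale n) (3 * scale 0) b - clamp (3 * scale n) (3 * scale 0) a.
Proof.
elim: n => [|n IH].
  have c t : clamp (3 * scale 0) (3 * scale 0) t = 3 * scale 0.
    by case: (clampP t (lexx (3 * scale 0))) =>
      [[? ->]|[/andP[? ?] ->]|[? ->]]; lra.
  by rewrite big_geq// !c subrr.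
have s0 := scale_gt0 n.
have ss : scale n <= 3 * scale n by lra.
have sn : 3 * scale n <= 3 * scale 0.
  by rewrite ler_pM2l// /scale expr0 mulr1 ler_piMr ?(ltW top_gt0)// exprn_ile1//; lra.
rewrite big_nat_recr//= IH (_ : 3 * scale n.+1 = scale n);
  last by rewrite scaleS; lra.
have := clamp_split a ss sn; have := clamp_split b ss sn;
  rewrite -!/(shell n _); lra.
Qed.

Lemma sum_shells_le n a b : a <= b ->
  \sum_(0 <= l < n) (shell l b - shell l a) <= b - a.
Proof.
move=> ab; rewrite sum_shells clampB_le//.
by rewrite ler_pM2l// /scale expr0 mulr1 ler_piMr ?(ltW top_gt0)// exprn_ile1//; lra.
Qed.

Lemma expected_cut_cost x y :
  \sum_z pr P [set w | decomposition w = z] *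
    cut_cost (decomposition_levels z) x y <=
  54 * harmonic_number R #|X| * dX x y.
Proof.
pose c l (z : {perm X} * {ffun 'I_K.+1 -> {ffun X * X -> bool}}) :=
  first_near z.1 (nearness z.2 l) x != first_near z.1 (nearness z.2 l) y.
apply: (@le_trans _ _ (\sum_z \sum_(0 <= l < K)
    pr P [set w | decomposition w = z] * ((c l z)%:R * (108 * scale l)))).
  apply: ler_sum => z _; rewrite -mulr_sumr ler_wpM2l ?pr_ge0//.
  by have := cut_cost_levels z.1 (nearness z.2) 0 K x y;
    rewrite /index_iota subn0.
rewrite exchange_big/=.
apply: (@le_trans _ _ (\sum_(0 <= l < K) \sum_v
    (54 * #|[pred u | near_dist x y u <= near_dist x y v]|%:R^-1) *
    (shell l (far_dist x y v) - shell l (near_dist x y v)))).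
  rewrite big_nat [leRHS]big_nat; apply: ler_sum => l /andP[_ lK].
  under eq_bigr do rewrite mulrA.
  rewrite -mulr_suml -(pr_pred (c l) rfin_decomposition).
  apply: le_trans (ler_wpM2r _ (pr_cut x y (ltnW lK))) _.
    by rewrite mulr_ge0// ltW// scale_gt0.
  rewrite mulr_suml le_eqVlt; apply/orP; left; apply/eqP; apply: eq_bigr => v _.
  have s0 := scale_gt0 l; set C := #|_|%:R^-1; field; rewrite gt_eqF//.
rewrite exchange_big/=.
apply: (@le_trans _ _ (\sum_v (54 * #|[pred u | near_dist x y u <=
  near_dist x y v]|%:R^-1) * dX x y)).
  apply: ler_sum => v _; rewrite -mulr_sumr ler_wpM2l ?mulr_ge0 ?invr_ge0//.
  apply: le_trans (sum_shells_le _ _) _; rewrite /near_dist /far_dist.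
    by rewrite ge_min !le_max !lexx.
  have := dX_triangle y v x; have := dX_triangle x v y; rewrite (dXC y x).
  by case: (leP (dX v x) (dX v y)); lra.
rewrite -mulr_suml -mulr_sumr ler_wpM2r// ler_wpM2l//.
exact: sum_inv_rank.
Qed.

End random_decomposition.

(** * Random variables on the unit interval *)

Section unit_interval_source.
Context (R : realType).

Definition unit_value (u : R) : R := if 0 <= u < 1 then u else 0.

Lemma unit_value_range u : 0 <= unit_value u < 1.
Proof. by rewrite /unit_value; case: ifP => // _; rewrite lexx ltr01. Qed.

Lemma measurable_unit_value : measurable_fun setT unit_value.
Proof.
apply: measurable_fun_ifT => //.
by apply: measurable_and; [exact: measurable_fun_ler|exact: measurable_fun_ltr].
Qed.

Lemma splits_unif : splits (@unif R) (@even_bits R) (@odd_bits R) unit_value.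
Proof.
split.
- exact: measurable_even_bits.
- exact: measurable_odd_bits.
- exact: measurable_unit_value.
- exact: unit_value_range.
- exact: even_bits_indep.
- move=> a b a0 ab b1; apply: unif_event => //.
    rewrite (_ : [set _ | _] = unit_value @^-1` `[a, b[).
      exact: (measurable_preimage measurable_unit_value).
    by apply/seteqP; split=> w /=; rewrite in_itv.
  by move=> u u0 u1; rewrite /= /unit_value u0 u1.
Qed.

End unit_interval_source.

(** The step is [ln (1 - 1/(n+2)) <= - 1/(n+2)]. *)
Lemma harmonic_number_le_ln (R : realType) n :
  harmonic_number R n.+1 <= 1 + ln n.+1%:R.
Proof.
elim: n => [|n IH].
  by rewrite /harmonic_number big_ord_recr big_ord0/= add0r invr1 ln1 addr0.
rewrite /harmonic_number big_ord_recr/=; apply: le_trans (lerD IH (lexx _)) _.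
have n2 : 0 < n.+2%:R :> R by [].
have n1 : 0 < n.+1%:R :> R by [].
have := @le_ln1Dx R (- n.+2%:R^-1).
have -> : 1 - n.+2%:R^-1 = n.+1%:R / n.+2%:R :> R.
  rewrite -{1}(divff (lt0r_neq0 n2)) -[X in _ - X]mul1r -mulrBl.
  by rewrite -[X in (X - 1) / _](natr1 n.+1) addrK.
rewrite ltrN2 invf_lt1 ?ltr1n// => /(_ isT).
rewrite ln_div ?posrE// => H.
by rewrite -addrA lerD2l -lerBrDl -lerN2 opprB.
Qed.

Section lebesgue_couplings.
Context (R : realType).
Local Notation mu := (@completed_lebesgue_measure R).

Lemma measurable_lebesgueType (A : set R) : measurable A ->
  measurable (A : set (lebesgueType R)).
Proof. exact: sub_caratheodory. Qed.

Lemma measurable_Omega : measurable (Omega R).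
Proof. by apply: measurable_lebesgueType; exact: measurable_itv. Qed.

Lemma mu_Omega : mu (Omega R) = 1%E.
Proof.
have : @lebesgue_measure R `[0, 1]%classic = 1%E.
  by rewrite lebesgue_measure_itv/= lte_fin ltr01 -EFinB subr0.
by [].
Qed.

Lemma mu_unif (A : set R) : measurable A -> mu (Omega R `&` A) = unif A.
Proof. by move=> mA; rewrite unifE// setIC. Qed.

(** Lebesgue measure on the unit interval as a probability, so that the lemmas on
    probabilities apply to arbitrary random variables on it. *)
Definition lebesgue_prob (A : set (lebesgueType R)) : \bar R :=
  mu (A `&` Omega R).

Let lebesgue_prob0 : lebesgue_prob set0 = 0%E.
Proof. by rewrite /lebesgue_prob set0I measure0. Qed.
Let lebesgue_prob_ge0 A : (0 <= lebesgue_prob A)%E.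
Proof. exact: measure_ge0. Qed.
Let lebesgue_prob_sigma_additive : semi_sigma_additive lebesgue_prob.
Proof. exact: (@measure_semi_sigma_additive _ _ _ (mrestr mu measurable_Omega)). Qed.

HB.instance Definition _ := isMeasure.Build _ _ _ lebesgue_prob
  lebesgue_prob0 lebesgue_prob_ge0 lebesgue_prob_sigma_additive.

Let lebesgue_prob_setT : lebesgue_prob setT = 1%E.
Proof. by rewrite /lebesgue_prob setTI mu_Omega. Qed.

HB.instance Definition _ := Measure_isProbability.Build _ _ _ lebesgue_prob
  lebesgue_prob_setT.

Context (X : finMetricType R).

(** Singletons are closed, and [X] is finite. *)
Lemma measurable_borel (B : set (borel X)) : measurable B.
Proof.
have m1 (x : X) : measurable ([set x] : set (borel X)).
  rewrite -[X in measurable X]setCK; apply: measurableC;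
    apply: sub_sigma_algebra.
  have : closed [set x] by apply: accessible_closed_set1;
    apply: hausdorff_accessible;
    exact: metric_hausdorff.
  by move=> cx; rewrite openC.
rewrite (_ : B = \bigcup_(x in B) [set x]); last first.
  by apply/seteqP; split=> [x Bx|x [y By ->]//]; exists x.
apply: fin_bigcup_measurable; last by move=> x _; exact: m1.
exact: finite_finset.
Qed.

Definition point_mass (Q : probability (borel X) R) (x : X) : R := pr Q [set x].

Lemma dist_point_mass Q : dist (point_mass Q).
Proof.
split; first by move=> x; exact: pr_ge0.
have m (A : set (borel X)) : measurable A by exact: measurable_borel.
rewrite -(pr_setT Q) -big_enum/= -pr_bigU ?enum_uniq//.
  congr pr; rewrite -bigcup_seq; apply/seteqP; split=> // x _.
  by exists x => //=; rewrite mem_enum.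
by move=> x y z /= <- <-.
Qed.

Lemma has_lawP (Y : R -> X) (Q : probability (borel X) R) :
  (forall x, measurable [set w | Y w = x]) ->
  (forall x, pr (@unif R) [set w | Y w = x] = point_mass Q x) ->
  has_law (R := R) (T := borel X) Y Q.
Proof.
move=> mY YQ.
have mYB (B : set X) : measurable [set w | B (Y w)] by exact: (rfin_pred B mY).
have E (B : set X) : pr (@unif R) [set w | B (Y w)] = pr Q B.
  have mQ : rfin (id : borel X -> X) by move=> x; exact: measurable_borel.
  rewrite (pr_total _ mY (mYB B)) (pr_total _ mQ (measurable_borel B)).
  apply: eq_bigr => x _; have [Bx|Bx] := pselect (B x).
    rewrite (_ : _ `&` _ = [set w | Y w = x]); last first.
      by apply/seteqP; split=> w /=; [case|move=> ->].
    rewrite (_ : B `&` _ = [set x]) ?YQ//.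
    by apply/seteqP; split=> w /=; [case|move=> ->].
  rewrite (_ : _ `&` _ = set0); last first.
    by apply/seteqP; split=> w //= -[+ h]; rewrite h.
  rewrite (_ : B `&` _ = set0) ?pr_set0//.
  by apply/seteqP; split=> w //= -[+ h]; rewrite h.
split=> [_ B _|B mB].
  by apply: measurableI; [exact: measurable_Omega|exact: (measurable_lebesgueType (mYB B))].
rewrite (mu_unif (mYB B)) (prE Q (measurable_borel B)) -E.
exact: (prE (@unif R) (mYB B)).
Qed.

Lemma expected_cost_sum (c : X -> X -> R) (Y Z : lebesgueType R -> borel X) :
  (forall x y, 0 <= c x y) ->
  measurable_fun (Omega R) Y -> measurable_fun (Omega R) Z ->
  expected_cost (T := borel X) c Y Z =
  (\sum_x \sum_y c x y * pr lebesgue_prob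
     (Omega R `&` [set w | Y w = x /\ Z w = y]))%:E.
Proof.
move=> c0 mY mZ.
have mO := measurable_Omega.
pose A (xy : X * X) := Omega R `&` [set w | Y w = xy.1 /\ Z w = xy.2].
have mA xy : measurable (A xy).
  rewrite /A (_ : _ `&` _ = (Omega R `&` Y @^-1` [set xy.1]) `&`
    (Omega R `&` Z @^-1` [set xy.2])).
    by apply: measurableI; [apply: mY|apply: mZ] => //; exact: measurable_borel.
  by apply/seteqP; split=> w /= => [[h1 [h2 h3]]|[[h1 h2] [h3 h4]]].
rewrite /expected_cost.
transitivity (\int[mu]_(w in Omega R) \sum_(xy : X * X)
    ((c xy.1 xy.2)%:E * (\1_(A xy) w)%:E))%E.
  apply: eq_integral => w /set_mem Ow.
  rewrite (bigD1 (Y w, Z w))//= big1 ?adde0.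
    by rewrite indicE mem_set ?mule1//.
  move=> [x y] /= ne; rewrite indicE memNset ?mule0//.
  by move=> [_ /= [h1 h2]]; move: ne; rewrite h1 h2 eqxx.
rewrite (ge0_integral_sum mu mO (f := fun xy w =>
    ((c xy.1 xy.2)%:E * (\1_(A xy) w)%:E)%E)); last 2 first.
- by move=> xy; apply/measurable_EFinP; apply: measurable_funM.
- by move=> xy w _; rewrite -EFinM lee_fin mulr_ge0.
rewrite pair_bigA/= -sumEFin; apply: eq_bigr => xy _.
rewrite ge0_integralZl_EFin//; last first.
  by apply/measurable_EFinP; exact: measurable_indic.
rewrite integral_indic// EFinM -(prE lebesgue_prob (mA xy)).
by [].
Qed.

End lebesgue_couplings.

(** * The coupling of all distributions *)

Lemma fine_scale (R : realType) (X : finType) (dX : X -> X -> R) (top : R) :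
  exists K, forall x y, dX x y <= 18 * scale top K -> dX x y <= 0.
Proof.
pose e := \big[Num.min/1]_(xy : X * X | 0 < dX xy.1 xy.2) dX xy.1 xy.2.
have e0 : 0 < e.
  by rewrite /e; elim/big_ind: _ => // a b a0 b0; rewrite lt_min a0.
have c : (fun n => 18 * scale top n) @ \oo --> (18 * (top * 0) : R).
  by apply: cvgMr; apply: cvgMr; apply: cvg_expr; rewrite ger0_norm; lra.
rewrite !mulr0 in c.
have [K _ /(_ K (leqnn K)) HK] := cvgr_lt _ c _ e0.
exists K => x y dK; rewrite leNgt; apply/negP => d0.
move: dK; rewrite leNgt => /negP; apply; apply: lt_le_trans HK _.
exact: (@bigmin_le_cond _ _ _ _ (x, y)).
Qed.

Section universal_coupling.
Context (R : realType) (X : finType) (dX : X -> X -> R).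
Hypothesis dX_ge0 : forall x y, 0 <= dX x y.
Hypothesis dXx : forall x, dX x x = 0.
Hypothesis dXC : forall x y, dX x y = dX y x.
Hypothesis dX_triangle : forall y x z, dX x z <= dX x y + dX y z.
Context (d : measure_display) (T : measurableType d).
Variables (P : probability T R) (f g : T -> T) (U : T -> R).
Hypothesis src : splits P f g U.
Let mf := measurable_split1 src.
Let mg := measurable_split2 src.

(** The random object [W i] is independent of the index [Z] at which it is
    evaluated. *)
Lemma pr_two_stage (I J : finType) (Z : T -> I) (W : I -> T -> J) (Q : pred J) :
  rfin Z -> (forall i, rfin (W i)) ->
  pr P [set w | Q (W (Z (f w)) (g w))] =
  \sum_i pr P [set w | Z w = i] * pr P [set w | Q (W i w)].
Proof.
move=> mZ mW; have mZf := rfin_precomp mZ mf.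
have mWQ i : measurable [set w | Q (W i w)] by exact: (rfin_pred (fun j =>
  Q j) (mW i)).
have mQ : measurable [set w | Q (W (Z (f w)) (g w))].
  have h := rfin_ffun (fun i => rfin_precomp (mW i) mg).
  have := rfin_pred (fun ih : I * {ffun I -> J} =>
    Q (ih.2 ih.1)) (rfin_pair mZf h).
  by congr measurable; apply/seteqP; split=> w /=; rewrite ffunE.
rewrite (pr_total P mZf mQ); apply: eq_bigr => i _.
rewrite -(split_indep src)//.
by congr pr; apply/seteqP; split=> w /= [h1 h2]; split=> //; move: h1 h2;
  congruence.
Qed.

(** The hierarchy is drawn with [f], the descent through it with [g].  Given the
    hierarchy, every descent has the right law, so the mixture has it too. *)
Lemma universal_coupling (x0 : X) : exists Y : (X -> R) -> T -> X,
  [/\ forall p, rfin (Y p),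
      forall p x, dist p -> pr P [set w | Y p w = x] = p x &
      forall p q (gamma : X -> X -> R), dist p -> dist q ->
        (forall x y, 0 <= gamma x y) ->
        (forall x, \sum_y gamma x y = p x) ->
        (forall y, \sum_x gamma x y = q y) ->
        \sum_x \sum_y dX x y * pr P [set w | Y p w = x /\ Y q w = y] <=
        54 * harmonic_number R #|X| * \sum_x \sum_y dX x y * gamma x y].
Proof.
pose top := 1 + \sum_x \sum_y dX x y.
have top0 : 0 < top.
  by rewrite ltr_pwDl// sumr_ge0// => x _; rewrite sumr_ge0.
have d_top x y : dX x y <= 18 * scale top 0.
  rewrite /scale expr0 mulr1 /top (bigD1 x)//= (bigD1 y)//=.
  have : 0 <= \sum_(i | i != y) dX x i by rewrite sumr_ge0.
  have : 0 <= \sum_(i | i != x) \sum_j dX i j.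
    by rewrite sumr_ge0// => i _; rewrite sumr_ge0.
  have := dX_ge0 x y; lra.
have [K HK] := fine_scale dX top.
pose Z := decomposition dX top f g U K.
have mZ : rfin Z by exact: (rfin_decomposition dX top src).
pose lv := @decomposition_levels R X top K.
pose Y p w := descend f g U x0 (lv (Z (f w))) p (g w).
have prY p x : dist p -> pr P [set w | Y p w = x] = p x.
  move=> dp; have mp1 : mass p = 1 by exact: dp.2.
  have := @pr_two_stage _ _ Z (fun z => descend f g U x0 (lv z) p) (pred1 x) mZ
    (fun z => rfin_descend src x0 (lv z) p).
  have E (V : T -> X) : [set w | pred1 x (V w)] = [set w | V w = x].
    by apply/seteqP; split=> w /=; [move/eqP|move=> ->; rewrite eqxx].
  rewrite !E => ->.
  rewrite (eq_bigr (fun z => pr P [set w | Z w = z] * p x)); last first.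
    by move=> z _; rewrite E (pr_descend src) ?mp1 ?divr1//; exact: dp.1.
  have := pr_total P mZ measurableT; rewrite pr_setT => H.
  rewrite -mulr_suml -[RHS]mul1r H; congr (_ * _).
  by apply: eq_bigr => z _; rewrite setTI.
exists Y; split=> //.
  move=> p; have h := rfin_ffun (fun z =>
    rfin_precomp (rfin_descend src x0 (lv z) p) mg).
  have := rfin_comp (fun zh : _ * {ffun _ -> X} =>
    zh.2 zh.1) (rfin_pair (rfin_precomp mZ mf) h).
  by congr rfin; apply/funext => w /=; rewrite ffunE.
move=> p q gamma dp dq g0 gp gq.
have EY x y : pr P [set w | Y p w = x /\ Y q w = y] =
  \sum_z pr P [set w | Z w = z] *
    pr P [set w | descend f g U x0 (lv z) p w = x /\
      descend f g U x0 (lv z) q w = y].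
  have E (V V' : T -> X) : [set w | pred1 (x, y) (V w, V' w)] = [set w | V w =
    x /\ V' w = y].
    by apply/seteqP; split=> w /=; [move/eqP => [-> ->]|move=> [-> ->];
      rewrite eqxx].
  rewrite -E (@pr_two_stage _ _ Z (fun z w => (descend f g U x0 (lv z) p w,
    descend f g U x0 (lv z) q w)) (pred1 (x, y)) mZ).
    by apply: eq_bigr => z _; rewrite E.
  by move=> z; apply: rfin_pair; exact: (rfin_descend src).
have -> : \sum_x \sum_y dX x y * pr P [set w | Y p w = x /\ Y q w = y] =
    \sum_z pr P [set w | Z w = z] * mean_cost P f g U x0 dX (lv z) p q.
  under eq_bigr do under eq_bigr do rewrite EY mulr_sumr.
  under eq_bigr do rewrite exchange_big/=.
  rewrite exchange_big/=; apply: eq_bigr => z _; rewrite mulr_sumr.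
  by apply: eq_bigr => x _; rewrite mulr_sumr; apply: eq_bigr => y _;
    rewrite mulrCA.
apply: (@le_trans _ _ (\sum_z pr P [set w | Z w = z] *
    \sum_x \sum_y gamma x y * cut_cost (lv z) x y)).
  apply: ler_sum => z _.
  (* The bounds on diameters hold for the hierarchies that do occur. *)
  have [[w0 Zw0]|none] := pselect (exists w, Z w = z); last first.
    rewrite (_ : [set w | _] = set0) ?pr_set0 ?mul0r//.
    by apply/seteqP; split=> w //= Zw; apply: none; exists w.
  rewrite ler_wpM2l ?pr_ge0//; apply: (mean_cost_coupling src) => //.
    exact: levels_nonneg.
  have /andP[u0 u1] := unit_range src (g w0).
  have Nz l u x : (l < K)%N -> nearness z.2 l (u, x) =
      (dX u x <= scale top l * (1 + 2 * U (g w0))).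
    by move=> lK; rewrite -Zw0 /nearness /= !ffunE /= inordK// ltnW.
  apply: (@diam_levels_levels _ _ dX dXC dX_triangle top z.1 (nearness z.2) K K 0%N) => //.
  - move=> l u x lK; rewrite Nz// => h; apply: le_trans h _.
    by rewrite mulrC ler_wpM2r ?(ltW (scale_gt0 top0 _))//; lra.
  - by move=> l x lK; rewrite Nz// dXx mulr_ge0 ?(ltW (scale_gt0 top0 _))//;
      lra.
rewrite mulr_sumr; under eq_bigr do rewrite mulr_sumr.
rewrite exchange_big/=; apply: ler_sum => x _.
under eq_bigr do rewrite mulr_sumr.
rewrite exchange_big/= mulr_sumr; apply: ler_sum => y _.
under eq_bigr do rewrite mulrCA.
rewrite -mulr_sumr mulrA [leRHS]mulrC ler_wpM2l//.
exact: expected_cut_cost.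
Qed.

End universal_coupling.

Theorem theorem15 (R : realType) (X : finMetricType R) :
  (optimal_coupling_ratio (T := borel X) (@mdist R X)
     (fun P : probability (borel X) R => P)
   < (557%:R / 10%:R * (1 + ln #|X|%:R))%:E)%E.
Proof.
have card0 : (0 < #|X|)%N by apply/card_gt0P; exists point.
have ln0 : 0 <= ln #|X|%:R :> R by rewrite ln_ge0// ler1n.
pose r : R := 54 * (1 + ln #|X|%:R).
apply: (@le_lt_trans _ _ r%:E); last by rewrite lte_fin /r; lra.
have [Y [mY lawY costY]] := universal_coupling (@mdist_ge0 R X) (@mdistxx R X)
  (@metric_sym R X) (fun y x z =>
    @metric_triangle R X x y z) (splits_unif R) point.
pose V (Q : probability (borel X) R) : lebesgueType R -> borel X :=
  Y (point_mass Q).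
have lawV Q : has_law (V Q) Q.
  by apply: has_lawP; [exact: mY|move=> x; apply: lawY; exact: dist_point_mass].
apply: (@le_trans _ _ (coupling_ratio (T := borel X) (@mdist R X)
  (fun P : probability (borel X) R => P) V)).
  by apply: ereal_inf_lbound; exists V.
apply: ereal_inf_lbound; exists r => //; split; first by rewrite /r; lra.
move=> P Q.
have r0 : 0 < r by rewrite /r; lra.
rewrite -lee_pdivrMl//; apply: le_ereal_inf_tmp => _ [A [B [lawA lawB ->]]].
rewrite lee_pdivrMl//.
have [[mA AP] [mB BQ]] := (lawA, lawB).
rewrite (expected_cost_sum (@mdist_ge0 R X) (lawV P).1 (lawV Q).1).
rewrite (expected_cost_sum (@mdist_ge0 R X) mA mB) -EFinM lee_fin.
have mO := @measurable_Omega R.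
have mX (C : set (borel X)) : measurable C by exact: measurable_borel.
(* The joint law of the competing coupling, as a transport plan. *)
pose gamma (x y : X) := pr (@lebesgue_prob R)
  (Omega R `&` [set w | A w = x /\ B w = y]).
have mg x y : measurable (Omega R `&` [set w | A w = x /\ B w = y]).
  rewrite (_ : _ `&` _ = (Omega R `&` A @^-1` [set x]) `&` (Omega R `&`
    B @^-1` [set y])).
    by apply: measurableI; [apply: mA|apply: mB].
  by apply/seteqP; split=> w /= => [[h1 [h2 h3]]|[[h1 h2] [h3 h4]]].
have pr_law (C : set (lebesgueType R)) : pr (@lebesgue_prob R) (Omega R `&` C) =
    fine (completed_lebesgue_measure (Omega R `&` C)).
  by rewrite /pr /= /lebesgue_prob setIAC setIid.
have gA x : \sum_y gamma x y = point_mass P x.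
  rewrite /point_mass /pr -AP// -pr_law -big_enum/= -pr_bigU ?enum_uniq//.
    congr pr; rewrite -bigcup_seq; apply/seteqP; split=> w /=.
      by move=> [y _ [h1 [h2 _]]].
    by move=> [h1 h2]; exists (B w) => //=; rewrite mem_enum.
  by move=> y z w /= [_ [_ <-]] [_ [_ <-]].
have gB y : \sum_x gamma x y = point_mass Q y.
  rewrite /point_mass /pr -BQ// -pr_law -big_enum/= -pr_bigU ?enum_uniq//.
    congr pr; rewrite -bigcup_seq; apply/seteqP; split=> w /=.
      by move=> [x _ [h1 [_ h2]]].
    by move=> [h1 h2]; exists (A w) => //=; rewrite mem_enum.
  by move=> x z w /= [_ [<- _]] [_ [<- _]].
have prV x y : pr (@lebesgue_prob R) (Omega R `&` [set w | V P w = x /\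
  V Q w = y]) =
    pr (@unif R) [set w | Y (point_mass P) w = x /\ Y (point_mass Q) w = y].
  rewrite pr_law mu_unif//.
  exact: (rfin_pred (fun xy => xy.1 = x /\ xy.2 = y) (rfin_pair (mY _) (mY _))).
under eq_bigr do under eq_bigr do rewrite prV.
apply: le_trans (costY _ _ gamma (dist_point_mass P) (dist_point_mass Q) _ gA gB) _.
  by move=> x y; exact: pr_ge0.
rewrite ler_wpM2r//.
  by apply: sumr_ge0 => x _; apply: sumr_ge0 => y _;
    rewrite mulr_ge0 ?mdist_ge0 ?pr_ge0.
by rewrite /r ler_wpM2l// -(prednK card0) harmonic_number_le_ln.
Qed.
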